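(* The C*-algebra $C^*\big((\mathbb{Z}/2\mathbb{Z})\wr\mathbb{Z}\big)$ of the group $(\mathbb{Z}/2\mathbb{Z})\wr\mathbb{Z}$ is not strongly quasidiagonal.
   Context: $(\mathbb{Z}/2\mathbb{Z})\wr\mathbb{Z}=\big(\bigoplus_{\mathbb{Z}}\mathbb{Z}/2\mathbb{Z}\big)\rtimes\mathbb{Z}$ is the (restricted) wreath product (lamplighter group), with $\mathbb{Z}$ acting by translation of the index set. A separable set $\Omega\subset B(H)$, $H$ a separable Hilbert space, is quasidiagonal if there is an increasing sequence of compact self-adjoint projections $P_n$ with $P_n\to1_H$ strongly and $\|P_nT-TP_n\|\to0$ for every $T\in\Omega$. A separable C*-algebra $A$ is strongly quasidiagonal if $\sigma(A)$ is a quasidiagonal set of operators for every representation $\sigma$ of $A$ (on a separable Hilbert space). *)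

(* Defs.v *)
From HB Require Import structures.
From mathcomp Require Import all_boot all_order all_algebra finmap.
From mathcomp Require Import complex sesquilinear monalg.
From mathcomp Require Import all_classical all_reals.
From mathcomp Require Import topology normedtype sequences.

Set Implicit Arguments.
Unset Strict Implicit.
Unset Printing Implicit Defensive.

Import Order.TTheory GRing.Theory Num.Theory.
Import numFieldNormedType.Exports.

Local Open Scope classical_set_scope.
Local Open Scope complex_scope.
Local Open Scope ring_scope.
Local Open Scope quotient_scope.

(* [inner] is linear in its first argument and conjugate-linear in its second. *)
HB.mixin Record CompleteNormedModule_isHilbert (R : realType) H
    & CompleteNormedModule R[i] H := {
  inner : {dot H for @conjc R};
  normr_inner : forall x : H, `|x| ^+ 2 = inner x x
}.

#[short(type="hilbertType")]
HB.structure Definition Hilbert (R : realType) :=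
  {H of CompleteNormedModule R[i] H & CompleteNormedModule_isHilbert R H}.

(* Not necessarily unital C*-algebras. The product is a field of its own because
   the library has no non-unital rings, and its order/norm hierarchy does not
   allow a type to be both a ring and a normed module over another field. *)
HB.mixin Record CompleteNormedModule_isCStar (R : realType) A
    & CompleteNormedModule R[i] A := {
  cmul : A -> A -> A;
  cstar : A -> A;
  cmul_linearl : forall y : A, linear (cmul^~ y);
  cmul_linearr : forall x : A, linear (cmul x);
  cmulA : associative cmul;
  cstar_antilinear : forall (c : R[i]) (x y : A),
    cstar (c *: x + y) = c^*%C *: cstar x + cstar y;
  cstarM : forall x y : A, cstar (cmul x y) = cmul (cstar y) (cstar x);
  cstarK : involutive cstar;
  normr_cmul : forall x y : A, `|cmul x y| <= `|x| * `|y|;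
  normr_cstar : forall x : A, `|cmul (cstar x) x| = `|x| ^+ 2
}.

#[short(type="cstarType")]
HB.structure Definition CStar (R : realType) :=
  {A of CompleteNormedModule R[i] A & CompleteNormedModule_isCStar R A}.

Definition opnorm (R : realType) (H : hilbertType R) (T : H -> H) : R :=
  sup [set complex.Re `|T x| | x in [set x | `|x| <= 1]].

Record bounded_op (R : realType) (H : hilbertType R) := BoundedOp {
  bop :> {linear H -> H};
  bop_continuous : continuous bop
}.

Section Quasidiagonality.
Variable R : realType.

Definition compact_op (H : hilbertType R) (T : H -> H) : Prop :=
  compact (closure (T @` [set x | `|x| <= 1])).

Definition orthogonal_projection (H : hilbertType R) (P : H -> H) : Prop :=
  (forall x, P (P x) = P x) /\ (forall x y, inner (P x) y = inner x (P y)).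

Definition op_le (H : hilbertType R) (S T : H -> H) : Prop :=
  forall x, inner (S x) x <= inner (T x) x.

Definition separable_space (T : topologicalType) : Prop :=
  exists2 D : set T, countable D & dense D.

Definition quasidiagonal (H : hilbertType R) (Omega : set (bounded_op H)) : Prop :=
  exists P : nat -> bounded_op H,
    [/\ forall n, compact_op (P n) /\ orthogonal_projection (P n),
        forall m n, (m <= n)%N -> op_le (P m) (P n),
        forall x : H, P n x @[n --> \oo] --> x
      & forall T, Omega T ->
          opnorm (fun x => P n (T x) - T (P n x)) @[n --> \oo] --> (0 : R)].

(* *-homomorphisms from A to B(H); they are automatically contractive. They are
   not required to be nondegenerate. *)
Record representation (A : cstarType R) (H : hilbertType R) := Representation {
  rep :> A -> bounded_op H;
  rep_linear : forall (c : R[i]) (a b : A) (x : H),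
    rep (c *: a + b) x = c *: rep a x + rep b x;
  repM : forall (a b : A) (x : H), rep (cmul a b) x = rep a (rep b x);
  rep_star : forall (a : A) (x y : H),
    inner (rep a x) y = inner x (rep (cstar a) y)
}.

Definition strongly_quasidiagonal (A : cstarType R) : Prop :=
  forall (H : hilbertType R) (sigma : representation A H),
    separable_space H -> quasidiagonal (range sigma).

End Quasidiagonality.

(* *-algebras with a submultiplicative C*-seminorm; their Hausdorff completions
   are C*-algebras. *)
HB.mixin Record Lmodule_isPreCStar (R : realType) A & GRing.Lmodule R[i] A := {
  pmul : A -> A -> A;
  pstar : A -> A;
  pnorm : A -> R;
  pmul_linearl : forall y : A, linear (pmul^~ y);
  pmul_linearr : forall x : A, linear (pmul x);
  pmulA : associative pmul;
  pstar_antilinear : forall (c : R[i]) (x y : A),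
    pstar (c *: x + y) = c^*%C *: pstar x + pstar y;
  pstarM : forall x y : A, pstar (pmul x y) = pmul (pstar y) (pstar x);
  pstarK : involutive pstar;
  pnormD : forall x y : A, pnorm (x + y) <= pnorm x + pnorm y;
  pnormZ : forall (c : R[i]) (x : A), pnorm (c *: x) = complex.Re `|c| * pnorm x;
  pnormM : forall x y : A, pnorm (pmul x y) <= pnorm x * pnorm y;
  pnorm_star : forall x : A, pnorm (pmul (pstar x) x) = pnorm x ^+ 2
}.
#[short(type="preCStarType")]
HB.structure Definition PreCStar (R : realType) :=
  {A of GRing.Lmodule R[i] A & Lmodule_isPreCStar R A}.

Section PreCStarTheory.
Variables (R : realType) (A : preCStarType R).
Implicit Types x y z : A.
Local Notation p := (@pnorm R A).

Lemma pmulDl x y z : pmul (x + y) z = pmul x z + pmul y z.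
Proof. by have := pmul_linearl z 1 x y; rewrite !scale1r. Qed.

Lemma pmulDr x y z : pmul x (y + z) = pmul x y + pmul x z.
Proof. by have := pmul_linearr x 1 y z; rewrite !scale1r. Qed.

Lemma pmul0l y : pmul 0 y = 0.
Proof. by have := pmulDl 0 0 y; rewrite addr0 -[LHS]addr0 => /addrI. Qed.

Lemma pmul0r x : pmul x 0 = 0.
Proof. by have := pmulDr x 0 0; rewrite addr0 -[LHS]addr0 => /addrI. Qed.

Lemma pmulBl x y z : pmul (x - y) z = pmul x z - pmul y z.
Proof. by rewrite [x - y]addrC -scaleN1r (pmul_linearl z) scaleN1r addrC. Qed.

Lemma pmulBr x y z : pmul x (y - z) = pmul x y - pmul x z.
Proof. by rewrite [y - z]addrC -scaleN1r (pmul_linearr x) scaleN1r addrC. Qed.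

Lemma pstarB x y : pstar (x - y) = pstar x - pstar y.
Proof.
by rewrite [x - y]addrC -scaleN1r pstar_antilinear rmorphN1 scaleN1r addrC.
Qed.

Lemma pnorm0 : p 0 = 0.
Proof. by rewrite -(scale0r (0 : A)) pnormZ normr0 mul0r. Qed.

Lemma pnormN x : p (- x) = p x.
Proof. by rewrite -scaleN1r pnormZ normrN1 mul1r. Qed.

Lemma pnorm_ge0 x : 0 <= p x.
Proof.
have := pnormD x (- x); rewrite subrr pnorm0 pnormN -mulr2n.
by rewrite pmulrn_lge0.
Qed.

Lemma pnormB x y : p (x - y) = p (y - x).
Proof. by rewrite -pnormN opprB. Qed.

Lemma pnorm_dist x y : `|p x - p y| <= p (x - y).
Proof.
have le u v : p u - p v <= p (u - v) by rewrite lerBlDr -{1}(subrK v u) pnormD.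
by rewrite ler_norml lerNl opprB pnormB !le pnormB le.
Qed.

Lemma pnormBD z x y : p (x - y) <= p (x - z) + p (z - y).
Proof. by rewrite -(subrKA z x) pnormD. Qed.

Lemma pnorm_pstar x : p (pstar x) = p x.
Proof.
have le y : p y <= p (pstar y).
  have [->|y0] := eqVneq (p y) 0; first exact: pnorm_ge0.
  have := pnormM (pstar y) y; rewrite pnorm_star expr2 ler_pM2r //.
  by rewrite lt_def y0 pnorm_ge0.
by apply/le_anti/andP; split => //; rewrite -{2}(pstarK x).
Qed.

Definition pcauchy (s : nat -> A) := forall e : R, 0 < e ->
  exists N, forall m n, (N <= m)%N -> (N <= n)%N -> p (s m - s n) < e.

Record cauchy_sequence := CauchySequence {
  cseq :> nat -> A;
  cseqP : pcauchy cseq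
}.

HB.instance Definition _ := gen_eqMixin cauchy_sequence.
HB.instance Definition _ := gen_choiceMixin cauchy_sequence.

Definition pnull (s : nat -> A) := forall e : R, 0 < e ->
  exists N, forall n, (N <= n)%N -> p (s n) < e.

Definition cequiv (s t : cauchy_sequence) : bool :=
  `[< pnull (fun n => s n - t n) >].

Lemma pnullD s t : pnull s -> pnull t -> pnull (fun n => s n + t n).
Proof.
move=> hs ht e e0; have e2 : 0 < e / 2 by rewrite divr_gt0.
have [N hN] := hs _ e2; have [M hM] := ht _ e2.
exists (maxn N M) => n; rewrite geq_max => /andP[/hN h1 /hM h2].
by rewrite (le_lt_trans (pnormD _ _)) // (splitr e) ltrD.
Qed.

Lemma pnull_le k s t : pnull s -> (forall n, p (t n) <= k * p (s n)) -> pnull t.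
Proof.
move=> hs kt e e0.
have k0 : 0 < Num.max k 1 by rewrite lt_max ltr01 orbT.
have [N hN] := hs (e / Num.max k 1) (divr_gt0 e0 k0).
exists N => n /hN; rewrite ltr_pdivlMr // mulrC; apply: le_lt_trans.
by rewrite (le_trans (kt n)) // ler_wpM2r ?pnorm_ge0 // le_max lexx.
Qed.

Lemma cequiv_refl : reflexive cequiv.
Proof. by move=> s; apply/asboolP => e e0; exists 0%N => n _; rewrite subrr pnorm0. Qed.

Lemma cequiv_sym : symmetric cequiv.
Proof.
by move=> s t; apply/asboolP/asboolP => h; apply: (@pnull_le 1 _ _ h) => n;
  rewrite mul1r pnormB.
Qed.

Lemma cequiv_trans : transitive cequiv.
Proof.
move=> t s u /asboolP h1 /asboolP h2; apply/asboolP.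
apply: (@pnull_le 1 _ _ (pnullD h1 h2)) => n.
by rewrite mul1r subrKA.
Qed.

Canonical cequiv_equiv := EquivRel cequiv cequiv_refl cequiv_sym cequiv_trans.

Lemma pcauchyD (s t : cauchy_sequence) : pcauchy (fun n => s n + t n).
Proof.
move=> e e0; have e2 : 0 < e / 2 by rewrite divr_gt0.
have [N hN] := cseqP s e2; have [M hM] := cseqP t e2.
exists (maxn N M) => m n; rewrite !geq_max => /andP[Nm Mm] /andP[Nn Mn].
by rewrite opprD addrACA (le_lt_trans (pnormD _ _)) // (splitr e) ltrD // ?hN ?hM.
Qed.

Lemma pcauchy_le k (s : cauchy_sequence) t :
  (forall m n, p (t m - t n) <= k * p (s m - s n)) -> pcauchy t.
Proof.
move=> kt e e0.
have k0 : 0 < Num.max k 1 by rewrite lt_max ltr01 orbT.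
have [N hN] := cseqP s (divr_gt0 e0 k0).
exists N => m n Nm Nn; have := hN _ _ Nm Nn.
rewrite ltr_pdivlMr // mulrC; apply: le_lt_trans.
by rewrite (le_trans (kt _ _)) // ler_wpM2r ?pnorm_ge0 // le_max lexx.
Qed.

Lemma pcauchyN (s : cauchy_sequence) : pcauchy (fun n => - s n).
Proof. by apply: (@pcauchy_le 1 s) => m n; rewrite mul1r -opprD pnormN. Qed.

Lemma pcauchyZ c (s : cauchy_sequence) : pcauchy (fun n => c *: s n).
Proof.
by apply: (@pcauchy_le (complex.Re `|c|) s) => m n; rewrite -scalerBr pnormZ.
Qed.

Lemma pcauchy_star (s : cauchy_sequence) : pcauchy (fun n => pstar (s n)).
Proof. by apply: (@pcauchy_le 1 s) => m n; rewrite mul1r -pstarB pnorm_pstar. Qed.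

Lemma pcauchy_cst x : pcauchy (fun=> x).
Proof. by move=> e e0; exists 0%N => m n _ _; rewrite subrr pnorm0. Qed.

Lemma cseq_bounded (s : cauchy_sequence) :
  exists2 M, 0 < M & forall n, p (s n) <= M.
Proof.
have [N hN] := cseqP s ltr01.
pose M := \sum_(i < N.+1) p (s i) + 1.
have M1 : 1 <= M by rewrite /M lerDr sumr_ge0 // => i _; exact: pnorm_ge0.
exists M => [|n]; first exact: lt_le_trans M1.
have le_sum i : (i < N.+1)%N -> p (s i) <= \sum_(i < N.+1) p (s i).
  move=> iN; rewrite (bigD1 (Ordinal iN)) //= lerDl sumr_ge0 // => j _.
  exact: pnorm_ge0.
have [nN|Nn] := ltnP n N.
  by rewrite (le_trans (le_sum n _)) ?lerDl // ltnS ltnW.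
rewrite -(subrK (s N) (s n)) (le_trans (pnormD _ _)) // addrC lerD ?le_sum //.
exact/ltW/hN.
Qed.

Lemma pmul_dist x y z t :
  p (pmul x y - pmul z t) <= p (x - z) * p y + p z * p (y - t).
Proof.
rewrite (le_trans (pnormBD (pmul z y) _ _)) //.
by rewrite -pmulBl -pmulBr lerD // pnormM.
Qed.

Lemma pcauchyM (s t : cauchy_sequence) : pcauchy (fun n => pmul (s n) (t n)).
Proof.
have [K K0 hK] := cseq_bounded s; have [L L0 hL] := cseq_bounded t.
move=> e e0; have e2 : 0 < e / 2 by rewrite divr_gt0.
have [N hN] := cseqP s (divr_gt0 e2 L0).
have [M hM] := cseqP t (divr_gt0 e2 K0).
exists (maxn N M) => m n; rewrite !geq_max => /andP[Nm Mm] /andP[Nn Mn].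
rewrite (le_lt_trans (pmul_dist _ _ _ _)) // (splitr e) ltrD //.
  have := hN _ _ Nm Nn; rewrite ltr_pdivlMr //; apply: le_lt_trans.
  by rewrite ler_wpM2l ?pnorm_ge0.
have := hM _ _ Mm Mn; rewrite ltr_pdivlMr // mulrC; apply: le_lt_trans.
by rewrite ler_wpM2r ?pnorm_ge0.
Qed.

Definition cstar_completion := {eq_quot cequiv_equiv}.
HB.instance Definition _ := Choice.on cstar_completion.
HB.instance Definition _ := EqQuotient.on cstar_completion.

Local Notation Ahat := cstar_completion.
Implicit Types X Y Z : Ahat.

Definition hat_class (s : cauchy_sequence) : Ahat := \pi_Ahat s.
Definition hat_lim s (hs : pcauchy s) : Ahat := hat_class (CauchySequence hs).

Lemma hat_classP s t : hat_class s = hat_class t <-> pnull (fun n => s n - t n).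
Proof.
split=> [/eqP|h]; last by apply/eqP; rewrite eqmodE; apply/asboolP.
by rewrite eqmodE => /asboolP.
Qed.

Lemma hat_ind (P : Ahat -> Prop) : (forall s, P (hat_class s)) -> forall X, P X.
Proof. by move=> h; elim/quotW => s; exact: h. Qed.

Lemma hat_repr (s : cauchy_sequence) : pnull (fun n => repr (hat_class s) n - s n).
Proof. by apply/hat_classP; rewrite /hat_class reprK. Qed.

Lemma hat_ext (s t : cauchy_sequence) :
  pnull (fun n => s n - t n) -> hat_class s = hat_class t.
Proof. by move=> h; apply/hat_classP. Qed.

Lemma hat_ext1 (s t : cauchy_sequence) : s =1 t -> hat_class s = hat_class t.
Proof.
by move=> h; apply: hat_ext => e e0; exists 0%N => n _; rewrite h subrr pnorm0.
Qed.

Definition hat_zero : Ahat := hat_lim (pcauchy_cst 0).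
Definition hat_add X Y : Ahat := hat_lim (pcauchyD (repr X) (repr Y)).
Definition hat_opp X : Ahat := hat_lim (pcauchyN (repr X)).
Definition hat_scale c X : Ahat := hat_lim (pcauchyZ c (repr X)).
Definition hat_mul X Y : Ahat := hat_lim (pcauchyM (repr X) (repr Y)).
Definition hat_star X : Ahat := hat_lim (pcauchy_star (repr X)).

Lemma hat_addE s t : hat_add (hat_class s) (hat_class t) = hat_lim (pcauchyD s t).
Proof.
apply: hat_ext; apply: (@pnull_le 1 _ _ (pnullD (hat_repr s) (hat_repr t))) => n.
by rewrite mul1r opprD addrACA.
Qed.

Lemma hat_oppE s : hat_opp (hat_class s) = hat_lim (pcauchyN s).
Proof.
apply: hat_ext; apply: (@pnull_le 1 _ _ (hat_repr s)) => n.
by rewrite mul1r -opprD pnormN.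
Qed.

Lemma hat_scaleE c s : hat_scale c (hat_class s) = hat_lim (pcauchyZ c s).
Proof.
apply: hat_ext; apply: (@pnull_le (complex.Re `|c|) _ _ (hat_repr s)) => n.
by rewrite -scalerBr pnormZ.
Qed.

Lemma hat_starE s : hat_star (hat_class s) = hat_lim (pcauchy_star s).
Proof.
apply: hat_ext; apply: (@pnull_le 1 _ _ (hat_repr s)) => n.
by rewrite mul1r -pstarB pnorm_pstar.
Qed.

Lemma hat_mulE s t : hat_mul (hat_class s) (hat_class t) = hat_lim (pcauchyM s t).
Proof.
apply: hat_ext; have [L L0 hL] := cseq_bounded (repr (hat_class t)).
have [K K0 hK] := cseq_bounded s.
have h0 : pnull (fun n => pmul (repr (hat_class s) n) (repr (hat_class t) n) -
                          pmul (s n) (repr (hat_class t) n)).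
  apply: (@pnull_le L _ _ (hat_repr s)) => n.
  by rewrite -pmulBl (le_trans (pnormM _ _)) // mulrC ler_wpM2r ?pnorm_ge0.
have h1 : pnull (fun n => pmul (s n) (repr (hat_class t) n) -
                          pmul (s n) (t n)).
  apply: (@pnull_le K _ _ (hat_repr t)) => n.
  by rewrite -pmulBr (le_trans (pnormM _ _)) // ler_wpM2r ?pnorm_ge0.
by apply: (@pnull_le 1 _ _ (pnullD h0 h1)) => n; rewrite mul1r subrKA.
Qed.

Definition hatE := (hat_addE, hat_oppE, hat_scaleE, hat_starE, hat_mulE).

Lemma hat_addA : associative hat_add.
Proof.
elim/hat_ind => s; elim/hat_ind => t; elim/hat_ind => u.
by rewrite !hatE; apply: hat_ext1 => n /=; rewrite addrA.
Qed.

Lemma hat_addC : commutative hat_add.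
Proof.
elim/hat_ind => s; elim/hat_ind => t.
by rewrite !hatE; apply: hat_ext1 => n /=; rewrite addrC.
Qed.

Lemma hat_add0 : left_id hat_zero hat_add.
Proof.
by elim/hat_ind => s; rewrite !hatE; apply: hat_ext1 => n /=; rewrite add0r.
Qed.

Lemma hat_addN : left_inverse hat_zero hat_opp hat_add.
Proof.
by elim/hat_ind => s; rewrite !hatE; apply: hat_ext1 => n /=; rewrite addNr.
Qed.

HB.instance Definition _ :=
  GRing.isZmodule.Build Ahat hat_addA hat_addC hat_add0 hat_addN.

Lemma hat_classD s t : hat_class s + hat_class t = hat_lim (pcauchyD s t).
Proof. exact: hat_addE. Qed.

Lemma hat_scaleA a b X : hat_scale a (hat_scale b X) = hat_scale (a * b) X.
Proof.
by elim/hat_ind: X => s; rewrite !hatE; apply: hat_ext1 => n /=; rewrite scalerA.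
Qed.

Lemma hat_scale1 : left_id 1 hat_scale.
Proof.
by elim/hat_ind => s; rewrite !hatE; apply: hat_ext1 => n /=; rewrite scale1r.
Qed.

Lemma hat_scaleDr : right_distributive hat_scale +%R.
Proof.
move=> c X Y; elim/hat_ind: X => s; elim/hat_ind: Y => t.
by rewrite hat_classD !hatE [RHS]hat_classD; apply: hat_ext1 => n /=; rewrite scalerDr.
Qed.

Lemma hat_scaleDl X : {morph hat_scale^~ X : a b / a + b}.
Proof.
move=> a b; elim/hat_ind: X => s.
by rewrite !hatE hat_classD; apply: hat_ext1 => n /=; rewrite scalerDl.
Qed.

HB.instance Definition _ := GRing.Zmodule_isLmodule.Build R[i] Ahat
  hat_scaleA hat_scale1 hat_scaleDr hat_scaleDl.

Lemma hat_classZ c s : c *: hat_class s = hat_lim (pcauchyZ c s).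
Proof. exact: hat_scaleE. Qed.
Lemma hat_class0 : 0 = hat_lim (pcauchy_cst 0). Proof. by []. Qed.

Lemma cseq_cvg (s : cauchy_sequence) : cvgn (fun n => p (s n)).
Proof.
apply: cauchy_cvg; apply/cauchyP => e e0.
have [N hN] := cseqP s e0; exists (p (s N)), N => //= n /= Nn.
by rewrite /ball/= (le_lt_trans (pnorm_dist _ _)) // hN.
Qed.

Definition hat_norm X : R := limn (fun n => p (repr X n)).

Lemma hat_normE (s : cauchy_sequence) : hat_norm (hat_class s) = limn (fun n => p (s n)).
Proof.
apply/esym/cvg_lim => //; apply/cvgrPdist_lt => e e0.
have e2 : 0 < e / 2 by rewrite divr_gt0.
have /cvgrPdist_lt/(_ _ e2) [N _ hN] :
    (fun n => p (repr (hat_class s) n)) @ \oo --> hat_norm (hat_class s).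
  exact: cseq_cvg.
have [M hM] := hat_repr s e2.
exists (maxn N M) => //= n; rewrite /= geq_max => /andP[Nn Mn].
rewrite (le_lt_trans (ler_distD (p (repr (hat_class s) n)) _ _)) //.
rewrite (splitr e) ltrD //; first exact: hN.
by rewrite (le_lt_trans (pnorm_dist _ _)) // hM.
Qed.

Lemma hat_norm_le (s : cauchy_sequence) k :
  (exists N, forall n, (N <= n)%N -> p (s n) <= k) -> hat_norm (hat_class s) <= k.
Proof.
move=> [N hN]; rewrite hat_normE; apply: limr_le; first exact: cseq_cvg.
by exists N.
Qed.

Lemma hat_norm_lim (s : cauchy_sequence) : (fun n => p (s n)) @ \oo --> hat_norm (hat_class s).
Proof. by rewrite hat_normE; exact: cseq_cvg. Qed.

Lemma hat_normD X Y : hat_norm (X + Y) <= hat_norm X + hat_norm Y.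
Proof.
elim/hat_ind: X => s; elim/hat_ind: Y => t; rewrite hat_classD.
apply: (@ler_cvg_to _ \oo _ _ (fun n => p (s n + t n)) (fun n => p (s n) + p (t n))).
- exact: (@hat_norm_lim (CauchySequence (pcauchyD s t))).
- by apply: cvgD; exact: hat_norm_lim.
- by apply: nearW => n; exact: pnormD.
Qed.

Lemma hat_normZ c X : hat_norm (c *: X) = complex.Re `|c| * hat_norm X.
Proof.
elim/hat_ind: X => s; rewrite hat_classZ.
have h := @hat_norm_lim (CauchySequence (pcauchyZ c s)).
apply: (@cvg_unique R^o (@Rhausdorff R) _ _ _ _ h)=> /=.
rewrite (_ : (fun n : nat => _) = fun n => complex.Re `|c| * p (s n)); last first.
  by apply/funext => n /=; rewrite pnormZ.
by apply: cvgMr; exact: hat_norm_lim.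
Qed.

Lemma hat_norm_eq0 X : hat_norm X = 0 -> X = 0.
Proof.
elim/hat_ind: X => s s0; apply/hat_classP => e e0.
have := @hat_norm_lim s; rewrite s0 => /cvgrPdist_lt/(_ _ e0) [N _ hN].
exists N => n Nn /=; have := hN n Nn.
by rewrite /= sub0r normrN ger0_norm ?pnorm_ge0 // subr0.
Qed.

Lemma hat_normCD X Y : (hat_norm (X + Y))%:C <= (hat_norm X)%:C + (hat_norm Y)%:C.
Proof. by rewrite -rmorphD lecR hat_normD. Qed.

Lemma hat_normCZ (c : R[i]) X : (hat_norm (c *: X))%:C = `|c| * (hat_norm X)%:C.
Proof. by rewrite hat_normZ -[in RHS](RRe_real (normr_real c)) -rmorphM. Qed.

Lemma hat_normC_eq0 X : (hat_norm X)%:C = 0 -> X = 0.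
Proof. by move=> /complexI/hat_norm_eq0. Qed.

HB.instance Definition _ := Lmodule_isNormed.Build R[i] Ahat
  hat_normCD hat_normCZ hat_normC_eq0.

Lemma hat_normrE X : `|X| = (hat_norm X)%:C. Proof. by []. Qed.

Definition hat_inj (x : A) : Ahat := hat_lim (pcauchy_cst x).

Lemma hat_injN x : hat_inj (- x) = - hat_inj x.
Proof. by apply/esym/(etrans (hat_oppE _)); exact: hat_ext1. Qed.

Lemma hat_injB x y : hat_inj x - hat_inj y = hat_inj (x - y).
Proof. by rewrite -hat_injN hat_classD; exact: hat_ext1. Qed.

Lemma hat_norm_inj x : hat_norm (hat_inj x) = p x.
Proof.
have h := @hat_norm_lim (CauchySequence (pcauchy_cst x)).
apply: (@cvg_unique R^o (@Rhausdorff R) _ _ _ _ h) => /=.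
exact: cvg_cst.
Qed.

Lemma hat_dense X (e : R) : 0 < e -> exists x, hat_norm (X - hat_inj x) <= e.
Proof.
elim/hat_ind: X => s e0; have [N hN] := cseqP s e0; exists (s N).
by rewrite -hat_injN hat_classD; apply: hat_norm_le; exists N => n Nn; exact/ltW/hN.
Qed.

Lemma hat_complete (F : set_system Ahat) : ProperFilter F -> cauchy F -> cvg F.
Proof.
move=> FF /cauchyP Fc.
have pos (n : nat) : 0 < (n.+1%:R^-1 : R) by rewrite invr_gt0.
have /choice[a Fa] : forall n : nat, exists x : A,
    F [set Y | hat_norm (hat_inj x - Y) < n.+1%:R^-1].
  move=> n; have e2 : 0 < (n.+1%:R^-1 / 2 : R) by rewrite divr_gt0.
  have [|X] := Fc (n.+1%:R^-1 / 2)%:C; first by rewrite ltcR.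
  rewrite -ball_normE => FX; have [x Xx] := hat_dense X e2.
  exists x; apply: filterS FX => Y; rewrite /= hat_normrE ltcR => XY.
  rewrite -(subrKA X) (le_lt_trans (hat_normD _ _)) // [ltRHS]splitr.
  by rewrite ler_ltD // -[_ - X]opprB -lecR -hat_normrE normrN hat_normrE lecR.
have dist_a m n : p (a m - a n) < m.+1%:R^-1 + n.+1%:R^-1.
  have [Y [/= Ym Yn]] := @filter_ex _ F FF _ (@filterI _ F _ _ _ (Fa m) (Fa n)).
  rewrite -hat_norm_inj -hat_injB -(subrKA Y) (le_lt_trans (hat_normD _ _)) //.
  by rewrite ltrD // -ltcR -hat_normrE distrC hat_normrE ltcR.
have small (e : R) : 0 < e -> exists N : nat, forall n, (N <= n)%N -> n.+1%:R^-1 < e.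
  move=> e0; exists (Num.truncn e^-1) => n Nn.
  rewrite invf_plt ?posrE //.
  by rewrite (lt_le_trans (truncnS_gt _)) // ler_nat ltnS.
have ca : pcauchy a.
  move=> e e0; have e2 : 0 < e / 2 by rewrite divr_gt0.
  have [N hN] := small _ e2; exists N => m n Nm Nn.
  by rewrite (lt_trans (dist_a m n)) // [ltRHS]splitr ltrD // hN.
apply/cvg_ex; exists (hat_lim ca); apply/cvgrPdist_lt => e e0.
have eE : e = (complex.Re e)%:C by rewrite RRe_real // gtr0_real.
have e2 : 0 < complex.Re e / 2 by move: e0; rewrite {1}eE ltcR => /divr_gt0->.
have [N hN] := small _ e2; have [M hM] := ca _ e2; pose K := maxn N M.
apply: filterS (Fa K) => Y /= YK; rewrite hat_normrE eE ltcR.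
rewrite -(subrKA (hat_inj (a K))) (le_lt_trans (hat_normD _ _)) //.
rewrite [ltRHS]splitr ler_ltD //; last by rewrite (lt_trans YK) // hN ?leq_maxl.
rewrite -hat_injN hat_classD; apply: hat_norm_le; exists M => n Mn.
by apply/ltW/hM => //; exact: leq_maxr.
Qed.

HB.instance Definition _ := Uniform_isComplete.Build Ahat hat_complete.

Lemma hat_mul_linearl Y : linear (hat_mul^~ Y).
Proof.
move=> c X Z; elim/hat_ind: X => s; elim/hat_ind: Y => t; elim/hat_ind: Z => u.
rewrite /= hat_classZ hat_classD !hat_mulE hat_classZ hat_classD.
by apply: hat_ext1 => n /=; rewrite (pmul_linearl (t n)).
Qed.

Lemma hat_mul_linearr X : linear (hat_mul X).
Proof.
move=> c Y Z; elim/hat_ind: X => s; elim/hat_ind: Y => t; elim/hat_ind: Z => u.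
rewrite /= hat_classZ hat_classD !hat_mulE hat_classZ hat_classD.
by apply: hat_ext1 => n /=; rewrite (pmul_linearr (s n)).
Qed.

Lemma hat_mulA : associative hat_mul.
Proof.
elim/hat_ind => s; elim/hat_ind => t; elim/hat_ind => u.
by rewrite !hatE; apply: hat_ext1 => n /=; rewrite pmulA.
Qed.

Lemma hat_star_antilinear c X Y :
  hat_star (c *: X + Y) = c^*%C *: hat_star X + hat_star Y.
Proof.
elim/hat_ind: X => s; elim/hat_ind: Y => t.
rewrite hat_classZ hat_classD !hat_starE hat_classZ hat_classD.
by apply: hat_ext1 => n /=; rewrite pstar_antilinear.
Qed.

Lemma hat_starM X Y : hat_star (hat_mul X Y) = hat_mul (hat_star Y) (hat_star X).
Proof.
elim/hat_ind: X => s; elim/hat_ind: Y => t.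
by rewrite !hatE; apply: hat_ext1 => n /=; rewrite pstarM.
Qed.

Lemma hat_starK : involutive hat_star.
Proof.
by elim/hat_ind => s; rewrite !hatE; apply: hat_ext1 => n /=; rewrite pstarK.
Qed.

Lemma hat_normM X Y : `|hat_mul X Y| <= `|X| * `|Y|.
Proof.
elim/hat_ind: X => s; elim/hat_ind: Y => t.
rewrite !hat_normrE -rmorphM lecR hat_mulE.
apply: (@ler_cvg_to _ \oo _ _ (fun n => p (pmul (s n) (t n)))
  (fun n => p (s n) * p (t n))).
- exact: (@hat_norm_lim (CauchySequence (pcauchyM s t))).
- by apply: cvgM; exact: hat_norm_lim.
- by apply: nearW => n; exact: pnormM.
Qed.

Lemma hat_norm_star X : `|hat_mul (hat_star X) X| = `|X| ^+ 2.
Proof.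
elim/hat_ind: X => s; rewrite !hat_normrE -rmorphXn/=; congr (_%:C).
rewrite hat_starE hat_mulE.
have h := @hat_norm_lim (CauchySequence
  (pcauchyM (CauchySequence (pcauchy_star s)) s)).
apply: (@cvg_unique R^o (@Rhausdorff R) _ _ _ _ h)=> /=.
rewrite (_ : (fun n : nat => _) = fun n => p (s n) * p (s n)); last first.
  by apply/funext => n /=; rewrite pnorm_star.
by rewrite expr2; apply: cvgM; exact: hat_norm_lim.
Qed.

HB.instance Definition _ := CompleteNormedModule_isCStar.Build R Ahat
  hat_mul_linearl hat_mul_linearr hat_mulA hat_star_antilinear hat_starM
  hat_starK hat_normM hat_norm_star.

End PreCStarTheory.

Section HilbertTheory.
Variables (R : realType) (H : hilbertType R).
Implicit Types x y z : H.

Lemma innerDl x y z : inner (x + y) z = inner x z + inner y z.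
Proof. exact: linearDl. Qed.

Lemma innerDr x y z : inner x (y + z) = inner x y + inner x z.
Proof. exact: linearDr. Qed.

Lemma innerZl c x y : inner (c *: x) y = c * inner x y.
Proof. exact: linearZl_LR. Qed.

Lemma innerZr c x y : inner x (c *: y) = c^*%C * inner x y.
Proof. exact: linearZr_LR. Qed.

Lemma inner0l y : inner 0 y = 0.
Proof. exact: linear0l. Qed.

Lemma inner0r x : inner x 0 = 0.
Proof. exact: linear0r. Qed.

Lemma innerC x y : inner x y = (inner y x)^*%C.
Proof. by rewrite (hermC (inner : {dot H for @conjc R})) expr0 mul1r. Qed.

Definition rnorm x : R := complex.Re `|x|.

Lemma rnormE x : `|x| = (rnorm x)%:C.
Proof. by rewrite /rnorm RRe_real ?normr_real. Qed.

Lemma rnorm_ge0 x : 0 <= rnorm x.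
Proof. by rewrite -ler0c -rnormE. Qed.

Lemma rnormD x y : rnorm (x + y) <= rnorm x + rnorm y.
Proof. by rewrite -lecR rmorphD/= -!rnormE ler_normD. Qed.

Lemma rnormZ c x : rnorm (c *: x) = complex.Re `|c| * rnorm x.
Proof.
apply: (@complexI R); rewrite -rnormE normrZ rnormE.
by rewrite -{1}(RRe_real (normr_real c)) -rmorphM.
Qed.

Lemma rnorm_sqr x : inner x x = (rnorm x ^+ 2)%:C.
Proof. by rewrite -normr_inner rnormE rmorphXn. Qed.

Lemma Re_inner_le x y : complex.Re (inner x y) <= rnorm x * rnorm y.
Proof.
have hxy : inner (x + y) (x + y) =
    inner x x + inner y y + (inner x y + (inner x y)^*%C).
  by rewrite hnormD expr0 mul1r.
have h : rnorm (x + y) ^+ 2 =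
    rnorm x ^+ 2 + rnorm y ^+ 2 + complex.Re (inner x y) *+ 2.
  have := congr1 (@complex.Re R) hxy; rewrite !rnorm_sqr.
  by case: (inner x y) => u v /= ->; rewrite mulr2n.
have := rnormD x y.
rewrite -(@ler_pXn2r _ 2) ?nnegrE ?addr_ge0 ?rnorm_ge0 // h sqrrD addrAC lerD2r.
by rewrite lerD2l lerMn2r.
Qed.

Definition bounded_by (M : R) (T : H -> H) := forall x, rnorm (T x) <= M * rnorm x.

Lemma opnorm_le M T : 0 <= M -> bounded_by M T -> opnorm T <= M.
Proof.
move=> M0 TM; apply: ge_sup.
  by exists (complex.Re `|T 0|), 0 => //=; rewrite normr0.
move=> _ [x /= x1 <-]; apply: (le_trans (TM x)).
by rewrite ler_piMr // -lecR -rnormE.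
Qed.

Lemma opnorm_ge0 M (T : {linear H -> H}) : bounded_by M T -> 0 <= opnorm T.
Proof.
move=> TM; apply: ub_le_sup; last first.
  by exists 0; rewrite /= ?linear0 normr0 ?ler01.
exists `|M| => _ [y /= y1 <-]; apply: (le_trans (TM y)).
apply: (le_trans (ler_norm _)); rewrite normrM ler_piMr //.
by rewrite ger0_norm ?rnorm_ge0 // -lecR -rnormE.
Qed.

Lemma opnorm_bound M (T : {linear H -> H}) : bounded_by M T ->
  bounded_by (opnorm T) T.
Proof.
move=> TM x; have [->|x0] := eqVneq x 0.
  by rewrite linear0 /rnorm normr0 mulr0.
have hx : 0 < rnorm x by rewrite -ltcR -rnormE normr_gt0.
have normxV : complex.Re `|((rnorm x)^-1)%:C| = (rnorm x)^-1.
  by rewrite ger0_norm // lecR invr_ge0 ltW.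
rewrite -ler_pdivrMr //.
have -> : rnorm (T x) / rnorm x = rnorm (T ((rnorm x)^-1%:C *: x)).
  by rewrite linearZ rnormZ normxV mulrC.
apply: ub_le_sup; last first.
  exists ((rnorm x)^-1%:C *: x) => //=.
  by rewrite rnormE rnormZ normxV mulVf ?gt_eqF.
exists `|M| => _ [y /= y1 <-]; apply: (le_trans (TM y)).
apply: (le_trans (ler_norm _)); rewrite normrM ler_piMr //.
by rewrite ger0_norm ?rnorm_ge0 // -lecR -rnormE.
Qed.

End HilbertTheory.

Section MalgExt.
Variables (K : zmodType) (G : choiceType) (V : zmodType).
Variable f : G -> K -> V.
Implicit Types a b : {malg K[G]}.

Definition malg_ext a : V := \sum_(g <- msupp a) f g a@_g.

Hypothesis fB : forall g, {morph f g : c d / c - d}.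

Let f0 g : f g 0 = 0.
Proof. by rewrite -(subrr (0 : K)) fB subrr. Qed.

Lemma malg_extEw (d : {fset G}) a : (msupp a `<=` d)%fset ->
  malg_ext a = \sum_(g <- d) f g a@_g.
Proof.
move=> le; rewrite /malg_ext; apply: big_fset_incl => // g _.
by move=> /mcoeff_outdom ->.
Qed.

Lemma malg_extB a b : malg_ext (a - b) = malg_ext a - malg_ext b.
Proof.
pose d := (msupp a `|` msupp b)%fset.
rewrite !(@malg_extEw d) ?fsubsetUl ?fsubsetUr //; last exact: msuppB_le.
by rewrite -sumrB; apply: eq_bigr => g _; rewrite mcoeffB fB.
Qed.

Lemma malg_ext0 : malg_ext 0 = 0.
Proof. by rewrite -(subrr (0 : {malg K[G]})) malg_extB subrr. Qed.

Lemma malg_extD a b : malg_ext (a + b) = malg_ext a + malg_ext b.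
Proof. by rewrite -[b in LHS]opprK -[- b]sub0r !malg_extB malg_ext0 sub0r opprK. Qed.

Lemma malg_extU c g : malg_ext << c *g g >> = f g c.
Proof.
rewrite (@malg_extEw [fset g]%fset) ?msuppU_le // big_seq_fset1.
by rewrite mcoeffU eqxx.
Qed.
End MalgExt.

Lemma malg_ind (K : zmodType) (G : choiceType) (P : {malg K[G]} -> Prop) :
  P 0 -> (forall a b, P a -> P b -> P (a + b)) ->
  (forall c g, P << c *g g >>) -> forall a, P a.
Proof. by move=> P0 PD PU a; rewrite (monalgE a); apply: big_ind. Qed.

Record unitary_rep (R : realType) (G : groupType) (H : hilbertType R) :=
  UnitaryRep {
    urep :> G -> {linear H -> H};
    urep1 : forall x, urep 1%g x = x;
    urepM : forall g h x, urep (g * h)%g x = urep g (urep h x);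
    urep_inner : forall g x y, inner (urep g x) (urep g y) = inner x y
  }.

Section GroupAlgebra.
Variables (R : realType) (G : groupType).

Definition group_algebra := {malg R[i][G]}.
HB.instance Definition _ := GRing.Lmodule.on group_algebra.
Implicit Types (a b : group_algebra).

(* Convolution: the bilinear extension of the product of G. *)
Definition gmul a b : group_algebra :=
  \sum_(g <- msupp a) \sum_(h <- msupp b) << a@_g * b@_h *g (g * h)%g >>.

Definition gstar a : group_algebra := \sum_(g <- msupp a) << (a@_g)^*%C *g (g^-1)%g >>.

Definition urep_alg (H : hilbertType R) (pi : unitary_rep G H) a (x : H) : H :=
  \sum_(g <- msupp a) a@_g *: pi g x.

(* The norm of the full group C*-algebra. The set is bounded above by the l^1-norm
   of [a], see [urep_alg_bounded]. *)
Definition universal_norm a : R :=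
  sup [set r | exists (H : hilbertType R) (pi : unitary_rep G H),
                 r = opnorm (urep_alg pi a)].

Lemma gmulBl b : {morph gmul^~ b : a d / a - d}.
Proof.
apply: (@malg_extB _ _ _ (fun g c => \sum_(h <- msupp b) << c * b@_h *g (g * h)%g >>)).
by move=> g c d; rewrite -sumrB; apply: eq_bigr => h _; rewrite mulrBl raddfB.
Qed.

Lemma gmulBr a : {morph gmul a : b d / b - d}.
Proof.
move=> b d; rewrite /gmul -sumrB; apply: eq_bigr => g _.
apply: (@malg_extB _ _ _ (fun h c => << a@_g * c *g (g * h)%g >>)).
by move=> h c e; rewrite mulrBr raddfB.
Qed.

Lemma gmulDl b : {morph gmul^~ b : a d / a + d}.
Proof.
apply: (@malg_extD _ _ _ (fun g c => \sum_(h <- msupp b) << c * b@_h *g (g * h)%g >>)).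
by move=> g c d; rewrite -sumrB; apply: eq_bigr => h _; rewrite mulrBl raddfB.
Qed.

Lemma gmulDr a : {morph gmul a : b d / b + d}.
Proof.
move=> b d; rewrite /gmul -big_split; apply: eq_bigr => g _.
apply: (@malg_extD _ _ _ (fun h c => << a@_g * c *g (g * h)%g >>)).
by move=> h c e; rewrite mulrBr raddfB.
Qed.

Lemma gmul0l b : gmul 0 b = 0.
Proof. by have /= := gmulBl b 0 0; rewrite !subrr. Qed.

Lemma gmul0r a : gmul a 0 = 0.
Proof. by have /= := gmulBr a 0 0; rewrite !subrr. Qed.

Lemma gmulU c g (d : R[i]) h :
  gmul << c *g g >> << d *g h >> = << c * d *g (g * h)%g >> :> group_algebra.
Proof.
apply: etrans (@malg_extU _ _ _ (fun g c => \sum_(h' <- msupp << d *g h >>)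
   << c * (<< d *g h >> : {malg R[i][G]})@_h' *g (g * h')%g >>) _ _ _) _ => //.
  by move=> k e e'; rewrite -sumrB; apply: eq_bigr => l _; rewrite mulrBl raddfB.
rewrite -[LHS]/(malg_ext (fun h d => << c * d *g (g * h)%g >>) << d *g h >>).
by rewrite malg_extU // => k e e'; rewrite mulrBr raddfB.
Qed.

Lemma gstarB : {morph gstar : a b / a - b}.
Proof.
apply: (@malg_extB _ _ _ (fun g c => << c^*%C *g (g^-1)%g >>)).
by move=> g c d; rewrite rmorphB raddfB.
Qed.

Lemma gstarD : {morph gstar : a b / a + b}.
Proof.
apply: (@malg_extD _ _ _ (fun g c => << c^*%C *g (g^-1)%g >>)).
by move=> g c d; rewrite rmorphB raddfB.
Qed.

Lemma gstar0 : gstar 0 = 0.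
Proof. by have /= := gstarB 0 0; rewrite !subrr. Qed.

Lemma gstarU c g : gstar << c *g g >> = << c^*%C *g (g^-1)%g >>.
Proof.
apply: (@malg_extU _ _ _ (fun g c => << c^*%C *g (g^-1)%g >>)).
by move=> k d e; rewrite rmorphB raddfB.
Qed.

Lemma scaleU e c g : e *: (<< c *g g >> : group_algebra) = << e * c *g g >>.
Proof. by apply/malgP => k; rewrite mcoeffZ !mcoeffU mulrnAr. Qed.

Lemma gmulZl e a b : gmul (e *: a) b = e *: gmul a b.
Proof.
elim/malg_ind: a => [|a d iha ihd|c g].
- by rewrite scaler0 !gmul0l scaler0.
- by rewrite scalerDr !gmulDl iha ihd scalerDr.
elim/malg_ind: b => [|a d iha ihd|c' g'].
- by rewrite !gmul0r scaler0.
- by rewrite !gmulDr iha ihd scalerDr.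
by rewrite scaleU !gmulU scaleU mulrA.
Qed.

Lemma gmulZr e a b : gmul a (e *: b) = e *: gmul a b.
Proof.
elim/malg_ind: b => [|b d iha ihd|c g].
- by rewrite scaler0 !gmul0r scaler0.
- by rewrite scalerDr !gmulDr iha ihd scalerDr.
elim/malg_ind: a => [|a d iha ihd|c' g'].
- by rewrite !gmul0l scaler0.
- by rewrite !gmulDl iha ihd scalerDr.
by rewrite scaleU !gmulU scaleU mulrCA.
Qed.

Lemma gmul_linearl b : linear (gmul^~ b).
Proof. by move=> e x y; rewrite gmulDl gmulZl. Qed.

Lemma gmul_linearr a : linear (gmul a).
Proof. by move=> e x y; rewrite gmulDr gmulZr. Qed.

Lemma gmulA : associative gmul.
Proof.
move=> a b d; elim/malg_ind: a => [|a1 a2 h1 h2|c g].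
- by rewrite !gmul0l.
- by rewrite !gmulDl h1 h2.
elim/malg_ind: b => [|a1 a2 h1 h2|c' g'].
- by rewrite !(gmul0l, gmul0r).
- by rewrite !(gmulDl, gmulDr) h1 h2.
elim/malg_ind: d => [|a1 a2 h1 h2|c'' g''].
- by rewrite !gmul0r.
- by rewrite !gmulDr h1 h2.
by rewrite !gmulU mulrA mulgA.
Qed.

Lemma gstar_antilinear c a b : gstar (c *: a + b) = c^*%C *: gstar a + gstar b.
Proof.
rewrite gstarD; congr (_ + _); elim/malg_ind: a => [|a1 a2 h1 h2|c' g].
- by rewrite scaler0 gstar0 scaler0.
- by rewrite scalerDr !gstarD h1 h2 scalerDr.
by rewrite scaleU !gstarU scaleU rmorphM.
Qed.

Lemma gstarM a b : gstar (gmul a b) = gmul (gstar b) (gstar a).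
Proof.
elim/malg_ind: a => [|a1 a2 h1 h2|c g].
- by rewrite !(gmul0l, gmul0r, gstar0).
- by rewrite !(gmulDl, gmulDr, gstarD) h1 h2.
elim/malg_ind: b => [|a1 a2 h1 h2|c' g'].
- by rewrite !(gmul0l, gmul0r, gstar0).
- by rewrite !(gmulDl, gmulDr, gstarD) h1 h2.
by rewrite !(gmulU, gstarU) rmorphM mulrC invgM.
Qed.

Lemma gstarK : involutive gstar.
Proof.
elim/malg_ind => [|a1 a2 h1 h2|c g].
- by rewrite !gstar0.
- by rewrite !gstarD h1 h2.
by rewrite !gstarU conjcK invgK.
Qed.

Section IntegratedForm.
Variables (H : hilbertType R) (pi : unitary_rep G H).

Lemma urep_algD x : {morph (urep_alg pi)^~ x : a b / a + b}.
Proof.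
apply: (@malg_extD _ _ _ (fun g c => c *: pi g x)).
by move=> g c d; rewrite scalerBl.
Qed.

Lemma urep_alg0 x : urep_alg pi 0 x = 0.
Proof.
apply: (@malg_ext0 _ _ _ (fun g c => c *: pi g x)).
by move=> g c d; rewrite scalerBl.
Qed.

Lemma urep_algU c g x : urep_alg pi << c *g g >> x = c *: pi g x.
Proof.
apply: (@malg_extU _ _ _ (fun g c => c *: pi g x)).
by move=> k d e; rewrite scalerBl.
Qed.

Lemma urep_alg_linear a : linear (urep_alg pi a).
Proof.
move=> c x y; rewrite /urep_alg scaler_sumr -big_split; apply: eq_bigr => g _.
by rewrite linearP scalerDr !scalerA mulrC.
Qed.

HB.instance Definition _ a :=
  GRing.isLinear.Build R[i] H H _ (urep_alg pi a) (urep_alg_linear a).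

Lemma urep_algZ c a x : urep_alg pi (c *: a) x = c *: urep_alg pi a x.
Proof.
elim/malg_ind: a => [|a1 a2 h1 h2|c' g].
- by rewrite scaler0 urep_alg0 scaler0.
- by rewrite scalerDr !urep_algD h1 h2 scalerDr.
by rewrite scaleU !urep_algU scalerA.
Qed.

Lemma urep_algM a b x : urep_alg pi (gmul a b) x = urep_alg pi a (urep_alg pi b x).
Proof.
elim/malg_ind: a => [|a1 a2 h1 h2|c g].
- by rewrite gmul0l !urep_alg0.
- by rewrite gmulDl !urep_algD h1 h2.
elim/malg_ind: b => [|a1 a2 h1 h2|c' g'].
- by rewrite gmul0r !urep_alg0 linear0.
- by rewrite gmulDr !urep_algD h1 h2 linearD.
by rewrite gmulU !urep_algU urepM linearZ scalerA.
Qed.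

Lemma urep_algJ a x y :
  inner (urep_alg pi a x) y = inner x (urep_alg pi (gstar a) y).
Proof.
elim/malg_ind: a => [|a1 a2 h1 h2|c g].
- by rewrite gstar0 !urep_alg0 inner0l inner0r.
- by rewrite gstarD !urep_algD innerDl innerDr h1 h2.
rewrite gstarU !urep_algU innerZl innerZr conjcK; congr (_ * _).
by rewrite -[RHS](urep_inner pi g) -urepM mulgV urep1.
Qed.

Lemma rnorm_urep g x : rnorm (pi g x) = rnorm x.
Proof.
apply/eqP; rewrite -(eqrXn2 (ltn0Sn 1)) ?rnorm_ge0 //; apply/eqP.
by apply: (@complexI R); rewrite -!rnorm_sqr urep_inner.
Qed.

Definition l1_norm a : R := \sum_(g <- msupp a) complex.Re `|a@_g|.

Lemma urep_alg_bounded a : bounded_by (l1_norm a) (urep_alg pi a).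
Proof.
move=> x; rewrite /l1_norm /urep_alg mulr_suml.
elim/big_ind2: _ => [|u r v s h1 h2|g _].
- by rewrite /rnorm normr0.
- by rewrite (le_trans (rnormD _ _)) // lerD.
by rewrite rnormZ rnorm_urep.
Qed.

End IntegratedForm.

Lemma Re_normr_ge0 (c : R[i]) : 0 <= complex.Re `|c|.
Proof. by rewrite -ler0c RRe_real ?normr_real. Qed.

Lemma l1_norm_ge0 a : 0 <= l1_norm a.
Proof. by apply: sumr_ge0 => g _; exact: Re_normr_ge0. Qed.

Lemma universal_norm_le a M : 0 <= M ->
  (forall (H : hilbertType R) (pi : unitary_rep G H), bounded_by M (urep_alg pi a)) ->
  universal_norm a <= M.
Proof.
move=> M0 h; rewrite /universal_norm; set S := (X in sup X).
have [->|S0] := eqVneq S set0; first by rewrite sup0.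
apply: ge_sup; first exact/set0P.
by move=> _ [H [pi ->]]; apply: opnorm_le.
Qed.

Lemma universal_norm_bound a (H : hilbertType R) (pi : unitary_rep G H) :
  bounded_by (universal_norm a) (urep_alg pi a).
Proof.
move=> x; apply: (le_trans (opnorm_bound (@urep_alg_bounded _ pi a) x)).
rewrite ler_wpM2r ?rnorm_ge0 //; apply: ub_le_sup; last by exists H, pi.
exists (l1_norm a) => _ [H' [pi' ->]].
by apply: opnorm_le; [exact: l1_norm_ge0|exact: urep_alg_bounded].
Qed.

Lemma universal_norm_ge0 a : 0 <= universal_norm a.
Proof.
rewrite /universal_norm; set S := (X in sup X).
have [->|/set0P[_ [H [pi _]]]] := eqVneq S set0; first by rewrite sup0.
apply: (le_trans (opnorm_ge0 (@urep_alg_bounded _ pi a))).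
apply: ub_le_sup; last by exists H, pi.
exists (l1_norm a) => _ [H' [pi' ->]].
by apply: opnorm_le; [exact: l1_norm_ge0|exact: urep_alg_bounded].
Qed.

Lemma universal_normD a b :
  universal_norm (a + b) <= universal_norm a + universal_norm b.
Proof.
apply: universal_norm_le => [|H pi x]; first by rewrite addr_ge0 ?universal_norm_ge0.
by rewrite urep_algD mulrDl (le_trans (rnormD _ _)) // lerD // universal_norm_bound.
Qed.

Lemma universal_normM a b :
  universal_norm (gmul a b) <= universal_norm a * universal_norm b.
Proof.
apply: universal_norm_le => [|H pi x]; first by rewrite mulr_ge0 ?universal_norm_ge0.
rewrite urep_algM (le_trans (universal_norm_bound _ _ _)) // -mulrA.
by rewrite ler_wpM2l ?universal_norm_ge0 // universal_norm_bound.
Qed.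

Lemma universal_normZ_le c a :
  universal_norm (c *: a) <= complex.Re `|c| * universal_norm a.
Proof.
apply: universal_norm_le => [|H pi x].
  by rewrite mulr_ge0 ?universal_norm_ge0 ?Re_normr_ge0.
rewrite urep_algZ rnormZ -mulrA ler_wpM2l ?Re_normr_ge0 //.
exact: universal_norm_bound.
Qed.

Lemma universal_normZ c a :
  universal_norm (c *: a) = complex.Re `|c| * universal_norm a.
Proof.
apply/le_anti; rewrite universal_normZ_le andTb.
have [->|c0] := eqVneq c 0; first by rewrite normr0 mul0r universal_norm_ge0.
have c1 : complex.Re `|c^-1| = (complex.Re `|c|)^-1.
  rewrite normfV -[in LHS](RRe_real (normr_real c)) -fmorphV.
  by [].
have c2 : 0 < complex.Re `|c| by rewrite -ltcR RRe_real ?normr_real // normr_gt0.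
have := universal_normZ_le c^-1 (c *: a).
by rewrite scalerA mulVf // scale1r c1 mulrC ler_pdivlMr // mulrC.
Qed.

Lemma universal_norm_sqr_le a :
  universal_norm a ^+ 2 <= universal_norm (gmul (gstar a) a).
Proof.
set M := universal_norm (gmul _ _).
have M0 : 0 <= M by exact: universal_norm_ge0.
rewrite -(sqr_sqrtr M0) ler_pXn2r ?nnegrE ?universal_norm_ge0 ?sqrtr_ge0 //.
apply: universal_norm_le => [|H pi x]; first exact: sqrtr_ge0.
rewrite -(@ler_pXn2r _ 2) ?nnegrE ?mulr_ge0 ?rnorm_ge0 ?sqrtr_ge0 //.
rewrite exprMn sqr_sqrtr // -[leLHS]/(complex.Re (rnorm (urep_alg pi a x) ^+ 2)%:C).
rewrite -rnorm_sqr urep_algJ -urep_algM (le_trans (Re_inner_le _ _)) //.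
rewrite mulrC expr2 mulrA ler_wpM2r ?rnorm_ge0 //.
exact: universal_norm_bound.
Qed.

Lemma universal_norm_gstar_le a : universal_norm a <= universal_norm (gstar a).
Proof.
have [->|a0] := eqVneq (universal_norm a) 0; first exact: universal_norm_ge0.
have := le_trans (universal_norm_sqr_le a) (universal_normM _ _).
by rewrite expr2 ler_pM2r // lt_def a0 universal_norm_ge0.
Qed.

Lemma universal_norm_star a :
  universal_norm (gmul (gstar a) a) = universal_norm a ^+ 2.
Proof.
apply/le_anti; rewrite universal_norm_sqr_le andbT.
rewrite (le_trans (universal_normM _ _)) // expr2 ler_wpM2r ?universal_norm_ge0 //.
by rewrite -[in leRHS](gstarK a) universal_norm_gstar_le.
Qed.

HB.instance Definition _ := Lmodule_isPreCStar.Build R group_algebra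
  gmul_linearl gmul_linearr gmulA gstar_antilinear gstarM gstarK
  universal_normD universal_normZ universal_normM universal_norm_star.

Definition group_cstar : cstarType R := cstar_completion group_algebra.


End GroupAlgebra.

(* Restricted wreath product of A by Z: {malg A[int]} is the direct sum of copies of
   A indexed by Z, and [shift n] moves the coordinate i to i + n. *)
Section WreathZ.
Variable A : zmodType.

Definition wreathZ : Type := ({malg A[int]} * int)%type.
HB.instance Definition _ := Choice.on wreathZ.

Implicit Types (f g : {malg A[int]}) (m n : int) (u v w : wreathZ).

Definition shift n f : {malg A[int]} := \sum_(i <- msupp f) << f@_i *g i + n >>.

Lemma shiftB n : {morph shift n : f g / f - g}.
Proof.
by apply: (@malg_extB _ _ _ (fun i c => << c *g i + n >>)) => i c d; rewrite raddfB.
Qed.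

Lemma shiftD n : {morph shift n : f g / f + g}.
Proof.
by apply: (@malg_extD _ _ _ (fun i c => << c *g i + n >>)) => i c d; rewrite raddfB.
Qed.

Lemma shiftn0 n : shift n 0 = 0.
Proof. by have /= := shiftB n 0 0; rewrite !subrr. Qed.

Lemma shiftN n f : shift n (- f) = - shift n f.
Proof. by rewrite -sub0r shiftB shiftn0 sub0r. Qed.

Lemma shiftU n c i : shift n << c *g i >> = << c *g i + n >>.
Proof.
by apply: (@malg_extU _ _ _ (fun i c => << c *g i + n >>)) => j d e; rewrite raddfB.
Qed.

Lemma shift0 f : shift 0 f = f.
Proof.
elim/malg_ind: f => [|f g hf hg|c i]; first by rewrite shiftn0.
  by rewrite shiftD hf hg.
by rewrite shiftU addr0.
Qed.

Lemma shift_shift m n f : shift m (shift n f) = shift (m + n) f.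
Proof.
elim/malg_ind: f => [|f g hf hg|c i]; first by rewrite !shiftn0.
  by rewrite !shiftD hf hg.
by rewrite !shiftU -addrA (addrC n).
Qed.

Lemma mcoeff_shift n f i : (shift n f)@_i = f@_(i - n).
Proof.
elim/malg_ind: f => [|f g hf hg|c j]; first by rewrite shiftn0 !mcoeff0.
  by rewrite shiftD !mcoeffD hf hg.
by rewrite shiftU !mcoeffU -subr_eq0 -[in RHS]subr_eq0 opprB addrA addrAC.
Qed.

Definition wone : wreathZ := (0, 0).
Definition wmul u v : wreathZ := (u.1 + shift u.2 v.1, u.2 + v.2).
Definition winv u : wreathZ := (- shift (- u.2) u.1, - u.2).

Lemma wmulA : associative wmul.
Proof.
by move=> u v w; rewrite /wmul /= shiftD shift_shift !addrA.
Qed.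

Lemma wmul1 : left_id wone wmul.
Proof. by case=> f n; rewrite /wmul /= shift0 !add0r. Qed.

Lemma wmulr1 : right_id wone wmul.
Proof. by case=> f n; rewrite /wmul /= shiftn0 !addr0. Qed.

Lemma wmulV : left_inverse wone winv wmul.
Proof. by case=> f n; rewrite /wmul /= !addNr. Qed.

Lemma wmulrV : right_inverse wone winv wmul.
Proof. by case=> f n; rewrite /wmul /= shiftN shift_shift subrr shift0 subrr. Qed.

HB.instance Definition _ :=
  isGroup.Build wreathZ wmulA wmul1 wmulr1 wmulV wmulrV.

End WreathZ.

Definition lamplighter : groupType := wreathZ 'Z_2.

(* Main.v *)
(* Let t move the lamplighter one step and let s switch the lamp at 0. On l^2(Z),
   a lamp configuration f acts as multiplication by (-1)^(sum of the f_j, j <= i)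
   and t as the bilateral shift, so that (1 - s)/2 is the projection onto l^2(N)
   and t (1 - s)/2 + (1 + s)/2 is an isometry S whose range is orthogonal to the
   basis vector d at 0. Suppose P is a compact projection with ||[P, S]|| < 1/4 and
   |Pd| >= 3/4 |d|. On the finite-dimensional range of P the compression PS is
   bounded below by 3/4, hence onto, and PSx = Pd for some x with |x| <= 4/3 |d|.
   Then 9/16 |d|^2 <= |Pd|^2 = <PSx - Sx, d> <= 1/3 |d|^2, which is absurd. *)

Require Import Defs.
From HB Require Import structures.
From mathcomp Require Import all_boot all_order all_algebra finmap.
From mathcomp Require Import complex sesquilinear monalg.
From mathcomp Require Import all_classical all_reals.
From mathcomp Require Import topology normedtype sequences summability.
From mathcomp Require Import zify ring lra.

Set Implicit Arguments.
Unset Strict Implicit.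
Unset Printing Implicit Defensive.

Import Order.TTheory GRing.Theory Num.Theory.
Import numFieldNormedType.Exports.

Local Open Scope classical_set_scope.
Local Open Scope complex_scope.
Local Open Scope ring_scope.

(* The passage to a representation is essential. With e = (1 - s)/2, the element t e + (1 - e) is an
   isometry exactly when (1 - e) t e = 0, that is, when t maps the range of e into itself. In the
   group algebra (1 + s) t (1 - s) is a combination of four distinct group elements, hence nonzero;
   on l^2(Z) it vanishes because the bilateral shift preserves l^2(N). The signs come from duality.
   The characters of the lamp group are the points of {0,1}^Z, and the sign attached to i is the
   indicator of ]-oo, i]. These points form a single orbit of the shift, which tends to the zero
   sequence at one end and to the constant sequence 1 at the other; this asymmetry is what makes s
   cut out a half-line. As for the constants, a commutator bound r and |Pd| >= c |d| give c^2 <= r /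
   (1 - r); the choice r = 1/4, c = 3/4 contradicts this since 9/16 > 1/3. Any unitary
   representation may be used, since the universal norm dominates its operator norm and so lets it
   extend to the completion. *)
#[local] Existing Instance totally_filter.

(** * Square-summable families *)

Section Totally.
Variables (R : realType) (I : choiceType).
Implicit Types (h : I -> R) (F : {fset I}).

Definition fsum h F : R := \sum_(i <- F) h i.

(** Unordered summation along the finite subsets of [I] directed by inclusion, so no enumeration of
    [I] has to be chosen. The value is meaningful only when [usummable h] holds. *)
Definition usum h : R := lim (fsum h @ totally).
Definition usummable h : Prop := exists l : R, fsum h @ totally --> l.

Lemma le_fsum h F F' : (forall i, 0 <= h i) -> (F `<=` F')%fset -> fsum h F <= fsum h F'.
Proof.
move=> h0 FF; rewrite /fsum (big_fsetID _ (mem F) F') /=.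
rewrite (_ : [fset x in F' | x \in F]%fset = F); last first.
  apply/fsetP => i; rewrite !inE; apply: andb_idl; exact: (fsubsetP FF).
by rewrite lerDl sumr_ge0.
Qed.

(** With nonnegative terms the finite sums form an increasing net, which converges to its
    supremum. *)
Lemma fsum_bounded_cvg h M : (forall i, 0 <= h i) -> (forall F, fsum h F <= M) ->
  usummable h.
Proof.
move=> h0 hM; exists (sup (range (fsum h))).
have hs : has_sup (range (fsum h)).
  by split; [exists (fsum h fset0), fset0|exists M => _ [F _ <-]].
apply/cvgrPdist_lt => e e0; have [_ [F0 _ <-] hF0] := sup_adherent e0 hs.
exists F0 => // F /= FF; have := le_fsum h0 FF => h1.
have h2 : fsum h F <= sup (range (fsum h)).
  by apply: ub_le_sup; [case: hs|exists F].
by rewrite ger0_norm ?subr_ge0 //; lra.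
Qed.

Lemma usum_cvg h : usummable h -> fsum h @ totally --> usum h.
Proof. by move=> /cvg_ex. Qed.

Lemma usum_unique h l : fsum h @ totally --> l -> usum h = l.
Proof. by move=> /cvg_lim; apply. Qed.

Lemma usum0 : usum (fun=> 0) = 0.
Proof.
apply: usum_unique; rewrite (_ : fsum _ = fun=> 0); first exact: cvg_cst.
by apply/funext => F; rewrite /fsum big1.
Qed.

Lemma fsum_lin c d h k :
  fsum (fun i => c * h i + d * k i) = (fun F => c * fsum h F + d * fsum k F).
Proof. by apply/funext => F; rewrite /fsum big_split !mulr_sumr. Qed.

Lemma fsum_lin_cvg c d h k : usummable h -> usummable k ->
  fsum (fun i => c * h i + d * k i) @ totally --> c * usum h + d * usum k.
Proof.
move=> hh hk; rewrite fsum_lin.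
by apply: cvgD; apply: cvgMr; exact: usum_cvg.
Qed.

Lemma usummable_lin c d h k : usummable h -> usummable k ->
  usummable (fun i => c * h i + d * k i).
Proof. by move=> hh hk; eexists; exact: fsum_lin_cvg. Qed.

Lemma usum_lin c d h k : usummable h -> usummable k ->
  usum (fun i => c * h i + d * k i) = c * usum h + d * usum k.
Proof. by move=> hh hk; apply/usum_unique/fsum_lin_cvg. Qed.

Lemma fsum_le_usum h F : (forall i, 0 <= h i) -> usummable h ->
  fsum h F <= usum h.
Proof.
move=> h0 hh; apply: limr_ge; first exact/cvg_ex.
by exists F => // F' /=; exact: le_fsum.
Qed.

Lemma usum_le h M : usummable h -> (forall F, fsum h F <= M) -> usum h <= M.
Proof. by move=> hh hM; apply: limr_le; [exact/cvg_ex|exact: nearW]. Qed.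

Lemma usum_ge0 h : (forall i, 0 <= h i) -> usummable h -> 0 <= usum h.
Proof.
by move=> h0 hh; apply: le_trans (fsum_le_usum fset0 h0 hh); rewrite /fsum big_seq_fset0.
Qed.

End Totally.

Section SquareSummable.
Variables (R : realType) (I : choiceType).
Local Notation C := R[i].
Implicit Types (x y : I -> C).

Definition normsq (z : C) : R := complex.Re z ^+ 2 + complex.Im z ^+ 2.

Lemma normsq_ge0 z : 0 <= normsq z.
Proof. by rewrite addr_ge0 ?sqr_ge0. Qed.

Lemma normsq0 : normsq 0 = 0.
Proof. by rewrite /normsq /= expr0n addr0. Qed.

Lemma eq_Re_Im (z w : C) :
  complex.Re z = complex.Re w -> complex.Im z = complex.Im w -> z = w.
Proof. by case: z w => [a b] [c d] /= -> ->. Qed.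

Lemma normsqM z w : normsq (z * w) = normsq z * normsq w.
Proof. by case: z w => [z1 z2] [w1 w2]; rewrite /normsq /=; ring. Qed.

(** By the parallelogram law, the gap between the two sides is 2 |c z - w|^2 minus the excess |c z -
    w|^2, hence a sum of two squares. *)
Lemma normsq_lin_le c z w : normsq (c * z + w) <= 2 * normsq c * normsq z + 2 * normsq w.
Proof.
rewrite -mulrA -normsqM; move: (c * z) => [u1 u2]; case: w => [w1 w2].
rewrite /normsq /= -subr_ge0; set u := (X in 0 <= X).
have -> : u = (u1 - w1) ^+ 2 + (u2 - w2) ^+ 2 by rewrite /u; ring.
by rewrite addr_ge0 ?sqr_ge0.
Qed.

(** Membership is a uniform bound on finite sums rather than the existence of a limit: it is checked
    without convergence arguments, and [fsum_bounded_cvg] recovers the limit. *)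
Definition ell2_pred : {pred I -> C} :=
  fun x => `[< exists M, forall F, fsum (fun i => normsq (x i)) F <= M >].

Lemma ell2_submod_closed : submod_closed ell2_pred.
Proof.
split=> [|c x y]; rewrite !unfold_in.
  apply/asboolP; exists 0 => F; rewrite /fsum big1 // => i _.
  by rewrite /normsq /= expr0n addr0.
move=> /asboolP[M hM] /asboolP[N hN]; apply/asboolP.
exists (2 * normsq c * M + 2 * N) => F.
apply: (@le_trans _ _ (2 * normsq c * fsum (fun i => normsq (x i)) F +
   2 * fsum (fun i => normsq (y i)) F)); last first.
  by rewrite lerD // ler_wpM2l ?mulr_ge0 ?normsq_ge0.
by rewrite /fsum !mulr_sumr -big_split; apply: ler_sum => i _; exact: normsq_lin_le.
Qed.

HB.instance Definition _ := GRing.isSubmodClosed.Build C (I -> C) ell2_pred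
  ell2_submod_closed.

Record ell2 := Ell2 { ell2_fun :> I -> C; ell2P : ell2_fun \in ell2_pred }.

HB.instance Definition _ := [isSub for ell2_fun].
HB.instance Definition _ := [Choice of ell2 by <:].
HB.instance Definition _ := [SubChoice_isSubLmodule of ell2 by <:].

Implicit Types u v w : ell2.

Lemma ell2_ext u v : u =1 v -> u = v.
Proof. by move=> uv; apply/val_inj/funext. Qed.

Lemma ell2DE u v i : (u + v) i = u i + v i. Proof. by []. Qed.
Lemma ell2BE u v i : (u - v) i = u i - v i. Proof. by []. Qed.
Lemma ell2ZE c u i : (c *: u) i = c * u i. Proof. by []. Qed.
Lemma ell20E i : (0 : ell2) i = 0. Proof. by []. Qed.

Lemma ell2_usummable u : usummable (fun i => normsq (u i)).
Proof.
have /asboolP[M hM] := ell2P u.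
by apply: fsum_bounded_cvg hM => i; exact: normsq_ge0.
Qed.

(** Polarisation writes the real part as a difference of two summable families of squares; imaginary
    parts then follow on replacing [v] by i [v]. *)
Lemma usummable_Re u v : usummable (fun i => complex.Re (u i * (v i)^*%C)).
Proof.
rewrite (_ : (fun i => _) =
    fun i => 4^-1 * normsq ((u + v) i) + (- 4^-1) * normsq ((u - v) i)).
  exact: usummable_lin (ell2_usummable _) (ell2_usummable _).
apply/funext => i; rewrite ell2DE ell2BE.
by case: (u i) (v i) => [a b] [c d]; rewrite /normsq /=; field.
Qed.

Lemma usummable_Im u v : usummable (fun i => complex.Im (u i * (v i)^*%C)).
Proof.
rewrite (_ : (fun i => _) = fun i => complex.Re (u i * (('i%C *: v) i)^*%C)).
  exact: usummable_Re.
apply/funext => i; rewrite ell2ZE.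
by case: (u i) (v i) => [a b] [c d]; rewrite /=; ring.
Qed.

Definition ell2_inner u v : C :=
  Complex (usum (fun i => complex.Re (u i * (v i)^*%C)))
          (usum (fun i => complex.Im (u i * (v i)^*%C))).

Lemma ell2_innerC u v : ell2_inner u v = (ell2_inner v u)^*%C.
Proof.
rewrite /ell2_inner /=; congr Complex.
  by congr usum; apply/funext => i; case: (u i) (v i) => [a b] [c d] /=; ring.
have := usum_lin (-1) 0 (usummable_Im v u) (usummable_Im v u).
rewrite mul0r addr0 mulN1r => <-; congr usum; apply/funext => i.
by case: (u i) (v i) => [a b] [c d] /=; ring.
Qed.

Lemma ell2_inner_linearl w c u v :
  ell2_inner (c *: u + v) w = c * ell2_inner u w + ell2_inner v w.
Proof.
rewrite /ell2_inner.
have Re1 := usum_lin (complex.Re c) (- complex.Im c) (usummable_Re u w) (usummable_Im u w).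
have Im1 := usum_lin (complex.Re c) (complex.Im c) (usummable_Im u w) (usummable_Re u w).
have Re2 := usum_lin 1 1 (usummable_lin (complex.Re c) (- complex.Im c)
  (usummable_Re u w) (usummable_Im u w)) (usummable_Re v w).
have Im2 := usum_lin 1 1 (usummable_lin (complex.Re c) (complex.Im c)
  (usummable_Im u w) (usummable_Re u w)) (usummable_Im v w).
rewrite !mul1r in Re2 Im2; rewrite Re1 in Re2; rewrite Im1 in Im2.
apply: eq_Re_Im; [rewrite [LHS]/complex.Re|rewrite [LHS]/complex.Im].
- transitivity (complex.Re c * usum (fun i => complex.Re (u i * (w i)^*%C))
    + - complex.Im c * usum (fun i => complex.Im (u i * (w i)^*%C))
    + usum (fun i => complex.Re (v i * (w i)^*%C))); last first.
    by case: c {Re1 Im1 Re2 Im2} => c1 c2 /=; ring.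
  rewrite -Re2; congr usum; apply/funext => i; rewrite ell2DE ell2ZE.
  by case: c {Re1 Im1 Re2 Im2} (u i) (v i) (w i) => [c1 c2] [a b] [d e] [f g] /=; ring.
- transitivity (complex.Re c * usum (fun i => complex.Im (u i * (w i)^*%C))
    + complex.Im c * usum (fun i => complex.Re (u i * (w i)^*%C))
    + usum (fun i => complex.Im (v i * (w i)^*%C))); last first.
    by case: c {Re1 Im1 Re2 Im2} => c1 c2 /=; ring.
  rewrite -Im2; congr usum; apply/funext => i; rewrite ell2DE ell2ZE.
  by case: c {Re1 Im1 Re2 Im2} (u i) (v i) (w i) => [c1 c2] [a b] [d e] [f g] /=; ring.
Qed.

Lemma ell2_inner_linearr w c u v :
  ell2_inner w (c *: u + v) = c^*%C * ell2_inner w u + ell2_inner w v.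
Proof.
by rewrite ell2_innerC ell2_inner_linearl (ell2_innerC w u) (ell2_innerC w v) rmorphD rmorphM.
Qed.

Definition ell2_sqnorm u : R := usum (fun i => normsq (u i)).

Lemma ell2_inner_self u : ell2_inner u u = (ell2_sqnorm u)%:C.
Proof.
rewrite /ell2_inner; congr Complex.
  by congr usum; apply/funext => i; case: (u i) => [a b]; rewrite /normsq /=; ring.
have := usum_lin 0 0 (usummable_Im u u) (usummable_Im u u).
rewrite !mul0r addr0 => E; rewrite -[RHS]E; congr usum; apply/funext => i.
by case: (u i) => [a b] /=; ring.
Qed.

Lemma ell2_sqnorm_ge0 u : 0 <= ell2_sqnorm u.
Proof. by apply: usum_ge0 (ell2_usummable u) => i; exact: normsq_ge0. Qed.

Lemma fsum_le_sqnorm u F : fsum (fun i => normsq (u i)) F <= ell2_sqnorm u.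
Proof. by apply: fsum_le_usum (ell2_usummable u) => i; exact: normsq_ge0. Qed.

Lemma normsq_le_sqnorm u i : normsq (u i) <= ell2_sqnorm u.
Proof. by have := fsum_le_sqnorm u [fset i]%fset; rewrite /fsum big_seq_fset1. Qed.

Lemma normsq_eq0 z : normsq z <= 0 -> z = 0.
Proof.
case: z => a b; rewrite /normsq /= => h.
have a0 := sqr_ge0 a; have b0 := sqr_ge0 b.
have /eqP : a ^+ 2 = 0 by lra.
have /eqP : b ^+ 2 = 0 by lra.
by rewrite !sqrf_eq0 => /eqP-> /eqP->.
Qed.

Lemma ell2_sqnorm_eq0 u : ell2_sqnorm u = 0 -> u = 0.
Proof.
move=> u0; apply: ell2_ext => i; apply: normsq_eq0; rewrite -u0.
exact: normsq_le_sqnorm.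
Qed.

Lemma ell2_sqnormZ c u : ell2_sqnorm (c *: u) = normsq c * ell2_sqnorm u.
Proof.
have := usum_lin (normsq c) 0 (ell2_usummable u) (ell2_usummable u).
rewrite mul0r addr0 => <-; congr usum; apply/funext => i.
by rewrite ell2ZE normsqM mul0r addr0.
Qed.

Definition ell2_norm u : R := Num.sqrt (ell2_sqnorm u).

Lemma sqr_ell2_norm u : ell2_norm u ^+ 2 = ell2_sqnorm u.
Proof. by rewrite sqr_sqrtr ?ell2_sqnorm_ge0. Qed.

Lemma ell2_norm_ge0 u : 0 <= ell2_norm u. Proof. exact: sqrtr_ge0. Qed.

Lemma ell2_norm_eq0 u : ell2_norm u = 0 -> u = 0.
Proof. by move=> h; apply: ell2_sqnorm_eq0; rewrite -sqr_ell2_norm h expr0n. Qed.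

(* Pointwise [|a + b|^2 <= (1 + t) |a|^2 + (1 + t^-1) |b|^2]; the best choice
   of [t] is the ratio of the two norms. *)
Lemma ell2_normD u v : ell2_norm (u + v) <= ell2_norm u + ell2_norm v.
Proof.
have [/ell2_norm_eq0->|u0] := eqVneq (ell2_norm u) 0.
  by rewrite add0r lerDr ell2_norm_ge0.
have [/ell2_norm_eq0->|v0] := eqVneq (ell2_norm v) 0.
  by rewrite addr0 lerDl ell2_norm_ge0.
set a := ell2_norm u in u0 *; set b := ell2_norm v in v0 *.
have a0 : 0 < a by rewrite lt_def u0 ell2_norm_ge0.
have b0 : 0 < b by rewrite lt_def v0 ell2_norm_ge0.
rewrite -(@ler_pXn2r _ 2) ?nnegrE ?addr_ge0 ?ell2_norm_ge0 // sqr_ell2_norm.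
have -> : (a + b) ^+ 2 = (1 + b / a) * ell2_sqnorm u + (1 + a / b) * ell2_sqnorm v.
  by rewrite -!sqr_ell2_norm -/a -/b; field; rewrite u0 v0.
apply: usum_le (ell2_usummable _) _ => F.
apply: (@le_trans _ _ ((1 + b / a) * fsum (fun i => normsq (u i)) F +
    (1 + a / b) * fsum (fun i => normsq (v i)) F)); last first.
  by rewrite lerD // ler_wpM2l ?fsum_le_sqnorm // addr_ge0 // divr_ge0 // ltW.
rewrite /fsum !mulr_sumr -big_split; apply: ler_sum => i _; rewrite ell2DE.
case: (u i) (v i) => [u1 u2] [v1 v2]; rewrite /normsq /= -subr_ge0.
set d := (X in 0 <= X).
have -> : d = ((b * u1 - a * v1) ^+ 2 + (b * u2 - a * v2) ^+ 2) / (a * b).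
  by rewrite /d; field; rewrite u0 v0.
by rewrite divr_ge0 ?addr_ge0 ?sqr_ge0 // mulr_ge0 // ltW.
Qed.

Lemma Re_normC (c : C) : complex.Re `|c| = Num.sqrt (normsq c).
Proof. by case: c. Qed.

Lemma ell2_normZ c u : ell2_norm (c *: u) = complex.Re `|c| * ell2_norm u.
Proof. by rewrite /ell2_norm ell2_sqnormZ sqrtrM ?normsq_ge0 // Re_normC. Qed.

Lemma ell2_normCD u v : (ell2_norm (u + v))%:C <= (ell2_norm u)%:C + (ell2_norm v)%:C.
Proof. by rewrite -rmorphD lecR ell2_normD. Qed.

Lemma ell2_normCZ c u : (ell2_norm (c *: u))%:C = `|c| * (ell2_norm u)%:C.
Proof. by rewrite ell2_normZ -[in RHS](RRe_real (normr_real c)) -rmorphM. Qed.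

Lemma ell2_normC_eq0 u : (ell2_norm u)%:C = 0 -> u = 0.
Proof. by move=> /complexI/ell2_norm_eq0. Qed.

HB.instance Definition _ := Lmodule_isNormed.Build C ell2
  ell2_normCD ell2_normCZ ell2_normC_eq0.

Lemma ell2_normrE u : `|u| = (ell2_norm u)%:C. Proof. by []. Qed.

End SquareSummable.

(** * Completeness of l^2 and its Hilbert space structure *)

Section Complete.
Variables (R : realType) (I : choiceType).
Local Notation C := R[i].
Local Notation ell2 := (ell2 R I).
Implicit Types (u v : ell2).

Lemma sqr_Re_le (z : C) : complex.Re z ^+ 2 <= normsq z.
Proof. by rewrite lerDl sqr_ge0. Qed.

Lemma sqr_Im_le (z : C) : complex.Im z ^+ 2 <= normsq z.
Proof. by rewrite lerDr sqr_ge0. Qed.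

(** Meant for [p] the real or the imaginary part: additivity and contractivity make each coordinate
    of a Cauchy filter a Cauchy filter of reals. *)
Lemma coord_cvg (F : set_system ell2) (p : C -> R) i :
  ProperFilter F -> cauchy F ->
  (forall z w, p z - p w = p (z - w)) -> (forall z, p z ^+ 2 <= normsq z) ->
  cvg ((fun u => p (u i)) @ F).
Proof.
move=> FF /cauchyP Fc pB ple; apply: cauchy_cvg; apply/cauchyP => e e0.
have [|u] := Fc e%:C; first by rewrite ltcR.
rewrite -ball_normE => Fu; exists (p (u i)).
suff : F [set v : ell2 | `|p (u i) - p (v i)| < e].
  by rewrite -ball_normE.
apply: filterS Fu => v; rewrite /= ell2_normrE ltcR pB => uv.
apply: le_lt_trans uv; rewrite -(@ler_pXn2r _ 2) ?nnegrE ?ell2_norm_ge0 //.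
rewrite real_normK ?num_real // sqr_ell2_norm (le_trans (ple _)) //.
exact: (normsq_le_sqnorm (u - v) i).
Qed.

Lemma fsum_cvg (T : Type) (F : set_system T) (FF : Filter F) (f : T -> I -> R) (l : I -> R) K :
  (forall i, f ^~ i @ F --> l i) -> fsum (f t) K @[t --> F] --> fsum l K.
Proof.
move=> fl; rewrite /fsum; elim: (enum_fset K) => [|i s ih].
  by rewrite big_nil; under eq_fun do rewrite big_nil; exact: cvg_cst.
rewrite big_cons; under eq_fun do rewrite big_cons.
exact: cvgD (fl i) ih.
Qed.

Lemma ell2_complete (F : set_system ell2) : ProperFilter F -> cauchy F -> cvg F.
Proof.
move=> FF Fc.
have Rc i := @coord_cvg F (@complex.Re R) i FF Fc (fun z w => esym (raddfB _ z w)) sqr_Re_le.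
have Ic i := @coord_cvg F (@complex.Im R) i FF Fc (fun z w => esym (raddfB _ z w)) sqr_Im_le.
pose x i : C := Complex (lim ((fun u => complex.Re (u i)) @ F))
                        (lim ((fun u => complex.Im (u i)) @ F)).
(* For fixed [K] the bound on the finite sums of |u - v|^2 passes to the coordinatewise limit in
   [v]. The result is uniform in [K], and serves both to put [x] in l^2 and to bound the distance to
   it. *)
have near (e : R) : 0 < e -> exists2 u, F [set v | ell2_norm (u - v) < e] &
    forall K, fsum (fun i => normsq (u i - x i)) K <= e ^+ 2.
  move=> e0; have /cauchyP Fc' := Fc.
  have [|u] := Fc' e%:C; first by rewrite ltcR.
  rewrite -ball_normE => Fu; exists u => [|K].
    by apply: filterS Fu => v; rewrite /= ell2_normrE ltcR.
  have lim_u : fsum (fun i => normsq ((u - v) i)) K @[v --> F] -->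
      fsum (fun i => normsq (u i - x i)) K.
    apply: (@fsum_cvg _ F _ (fun v i => normsq ((u - v) i))) => i.
    under eq_fun do rewrite ell2BE /normsq !raddfB.
    rewrite /normsq !raddfB.
    by apply: cvgD; apply: cvgM; apply: cvgB (cvg_cst _) _; [exact: Rc|exact: Rc|exact: Ic|exact: Ic].
  apply: (@ler_cvg_to _ F _ _ _ _ _ _ lim_u (cvg_cst (e ^+ 2))).
  apply: filterS Fu => v; rewrite /= ell2_normrE ltcR => uv.
  rewrite (le_trans (fsum_le_sqnorm (u - v) K)) // -sqr_ell2_norm.
  by rewrite ler_pXn2r ?nnegrE ?ell2_norm_ge0 ?ltW.
(* Any radius would do here: [x] is the difference of [u1] and the square-summable family
   [u1 - x]. *)
have [u1 _ hu1] := near 1 ltr01.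
have ux : (fun i => u1 i - x i) \in @ell2_pred R I by apply/asboolP; exists (1 ^+ 2).
have xP : x \in @ell2_pred R I.
  rewrite (_ : x = (u1 : I -> C) - (fun i => u1 i - x i)); last first.
    by apply/funext => i /=; rewrite !fctE opprB addrC subrK.
  by rewrite rpredB // ell2P.
apply/cvg_ex; exists (Ell2 xP); apply/cvgrPdist_lt => e e0.
have eE : e = (complex.Re e)%:C by rewrite RRe_real // gtr0_real.
have e2 : 0 < complex.Re e / 2 by move: e0; rewrite {1}eE ltcR => /divr_gt0->.
have [u Fu hu] := near _ e2.
apply: filterS Fu => v /= uv; rewrite eE ell2_normrE ltcR -(subrKA u).
rewrite (le_lt_trans (ell2_normD _ _)) // [ltRHS]splitr ler_ltD //.
have -> : Ell2 xP - u = (-1) *: (u - Ell2 xP) by rewrite scaleN1r opprB.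
rewrite ell2_normZ normrN1 mul1r -(@ler_pXn2r _ 2) ?nnegrE ?ell2_norm_ge0 ?(ltW e2) //.
by rewrite sqr_ell2_norm; exact: (usum_le (ell2_usummable (u - Ell2 xP)) hu).
Qed.

HB.instance Definition _ := Uniform_isComplete.Build ell2 ell2_complete.

Lemma ell2_inner_bilinear :
  bilinear_for *%R (@conjc R \; *%R) (@ell2_inner R I : ell2 -> ell2 -> C).
Proof.
split=> [w c u v|w c u v]; first exact: ell2_inner_linearl.
exact: ell2_inner_linearr.
Qed.

HB.instance Definition _ := bilinear_isBilinear.Build C ell2 ell2 C
  *%R (@conjc R \; *%R) (@ell2_inner R I) ell2_inner_bilinear.

Lemma ell2_inner_hermitian u v :
  ell2_inner u v = (-1) ^+ false * (ell2_inner v u)^*%C.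
Proof. by rewrite expr0 mul1r -ell2_innerC. Qed.

HB.instance Definition _ := isHermitianSesquilinear.Build C ell2
  false (@conjc R) (@ell2_inner R I) ell2_inner_hermitian.

Lemma ell2_inner_gt0 u : u != 0 -> 0 < ell2_inner u u.
Proof.
move=> u0; rewrite ell2_inner_self ltcR lt_def ell2_sqnorm_ge0 andbT.
by apply: contra_neq u0; exact: ell2_sqnorm_eq0.
Qed.

HB.instance Definition _ := isDotProduct.Build C ell2 (@ell2_inner R I) ell2_inner_gt0.

Lemma ell2_normr_inner u : `|u| ^+ 2 = ell2_inner u u.
Proof. by rewrite ell2_normrE -rmorphXn sqr_ell2_norm ell2_inner_self. Qed.

HB.instance Definition _ :=
  CompleteNormedModule_isHilbert.Build R ell2 ell2_normr_inner.

Lemma ell2_rnorm u : rnorm u = ell2_norm u. Proof. by []. Qed.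

End Complete.

(** * Finite truncations and separability of l^2 *)

Section Separable.
Variables (R : realType) (I : choiceType).
Local Notation C := R[i].
Local Notation ell2 := (ell2 R I).
Implicit Types (u v : ell2) (i j : I) (F : {fset I}).

Definition basis_fun j : I -> C := fun i => (i == j)%:R.

Lemma basis_subproof j : basis_fun j \in @ell2_pred R I.
Proof.
apply/asboolP; exists 1 => F.
have [jF|jF] := boolP (j \in F).
  rewrite /fsum (big_fsetD1 j) //= big1_seq ?addr0.
    by rewrite /basis_fun eqxx /normsq /= expr1n expr0n addr0.
  move=> i /andP[_]; rewrite !inE /basis_fun => /andP[/negbTE-> _].
  by rewrite normsq0.
rewrite /fsum big1_seq ?ler01 // => i /andP[_ iF].
rewrite /basis_fun (_ : i == j = false); first by rewrite normsq0.
by apply: contraNF jF => /eqP<-.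
Qed.

Definition ell2_basis j : ell2 := Ell2 (basis_subproof j).

Lemma ell2_basisE j i : ell2_basis j i = (i == j)%:R. Proof. by []. Qed.

Lemma ell2_sum_coord (T : Type) (s : seq T) (f : T -> ell2) i :
  (\sum_(t <- s) f t) i = \sum_(t <- s) f t i.
Proof. by elim: s => [|t s ih]; rewrite ?big_nil ?big_cons // ell2DE ih. Qed.

(** The squared distance from [u] to its truncation to [F] is at most the norm squared minus the sum
    over [F], which tends to 0 along [totally]. *)
Lemma ell2_truncation u (e : R) : 0 < e ->
  exists F, ell2_norm (u - \sum_(i <- F) u i *: ell2_basis i) < e.
Proof.
move=> e0; have := usum_cvg (ell2_usummable u).
have e2 : 0 < (e / 2) ^+ 2 by rewrite exprn_gt0 // divr_gt0.
move=> /cvgrPdist_lt /(_ _ e2) [F _ /(_ F)] /=; rewrite fsubset_refl => /(_ isT).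
rewrite -/(ell2_sqnorm u) ger0_norm ?subr_ge0 ?fsum_le_sqnorm // => hF.
exists F; set t := (X in u - X).
have tE i : (u - t) i = if i \in F then 0 else u i.
  rewrite ell2BE /t ell2_sum_coord.
  under eq_bigr do rewrite ell2ZE ell2_basisE.
  have [iF|iF] := boolP (i \in F).
    rewrite (big_fsetD1 i) //= eqxx mulr1 big1_seq ?addr0 ?subrr //.
    by move=> j /andP[_]; rewrite !inE eq_sym => /andP[/negbTE-> _]; rewrite mulr0.
  rewrite big1_seq ?subr0 // => j /andP[_ jF].
  rewrite (_ : i == j = false) ?mulr0 //.
  by apply: contraNF iF => /eqP->.
apply: (@le_lt_trans _ _ (e / 2)); last by lra.
rewrite -(@ler_pXn2r _ 2) ?nnegrE ?ell2_norm_ge0 ?divr_ge0 ?(ltW e0) //.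
rewrite sqr_ell2_norm; apply: (le_trans _ (ltW hF)).
apply: (usum_le (ell2_usummable _)) => G.
rewrite lerBrDr; apply: le_trans (fsum_le_sqnorm u (F `|` G)%fset).
(* Extension by zero of the sum over [F]: [u - t] lives off [F] and [nF] on [F], so over the union
   with [G] they add up termwise to the squares of [u]. *)
pose nF i := if i \in F then normsq (u i) else 0.
have -> : fsum (fun i => normsq (u i)) F = fsum nF (F `|` G)%fset.
  rewrite /fsum -(big_fset_incl _ (fsubsetUl F G)) => [|i _ /negbTE iF].
    by apply: eq_big_seq => i iF; rewrite /nF iF.
  by rewrite /nF iF.
apply: (@le_trans _ _ (fsum (fun i => normsq ((u - t) i)) (F `|` G)%fset +
    fsum nF (F `|` G)%fset)).
  by rewrite lerD2r le_fsum ?fsubsetUr // => i; exact: normsq_ge0.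
rewrite /fsum -big_split; apply: ler_sum => i _; rewrite tE /nF.
by case: ifP => _; rewrite ?normsq0 /= ?add0r ?addr0.
Qed.

(** This cruder bound allows the real and the imaginary part of a coefficient to be approximated by
    rationals separately. *)
Lemma ell2_norm_basisZ (z : C) j :
  ell2_norm (z *: ell2_basis j) <= `|complex.Re z| + `|complex.Im z|.
Proof.
rewrite -(@ler_pXn2r _ 2) ?nnegrE ?ell2_norm_ge0 ?addr_ge0 // sqr_ell2_norm.
apply: (usum_le (ell2_usummable _)) => F.
have le0 : normsq z <= (`|complex.Re z| + `|complex.Im z|) ^+ 2.
  rewrite sqrrD !real_normK ?num_real // /normsq lerD2r lerDl.
  by rewrite mulrn_wge0 // mulr_ge0.
apply: (le_trans _ le0).
have basis0 i : i != j -> normsq ((z *: ell2_basis j) i) = 0.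
  by move=> /negbTE ij; rewrite ell2ZE ell2_basisE ij mulr0 normsq0.
rewrite /fsum; have [jF|jF] := boolP (j \in F).
  rewrite (big_fsetD1 j jF) big1_seq ?Monoid.mulm1.
    by rewrite ell2ZE ell2_basisE eqxx mulr1.
  by move=> i /andP[_]; rewrite !inE => /andP[ij _]; exact: basis0.
rewrite big1_seq ?normsq_ge0 // => i /andP[_ iF].
by apply: basis0; apply: contraNneq jF => <-.
Qed.

(** Finitely supported vectors with Gaussian rational coefficients, coded by lists so that a
    countable [I] yields a countable dense set. *)
Definition rat_comb (s : seq (I * (rat * rat))) : ell2 :=
  \sum_(p <- s) Complex (ratr p.2.1) (ratr p.2.2) *: ell2_basis p.1.

Lemma rat_approx (x e : R) : 0 < e -> exists q : rat, `|x - ratr q| < e.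
Proof.
move=> e0; have /rat_in_itvoo[q] : x - e < x + e by lra.
by rewrite in_itv /= => /andP[h1 h2]; exists q; rewrite ltr_norml; lra.
Qed.

Lemma rat_comb_approx (u : ell2) (s : seq I) (e : R) : 0 < e ->
  exists q, ell2_norm (\sum_(i <- s) u i *: ell2_basis i - rat_comb q) < e.
Proof.
elim: s e => [|i s ih] e e0.
  exists [::]; rewrite /rat_comb !big_nil subrr -(scale0r (0 : ell2)) ell2_normZ.
  by rewrite normr0 mul0r.
have [q hq] := ih (e / 2) (divr_gt0 e0 (ltr0Sn _ _)).
have e4 : 0 < e / 4 by lra.
have [a ha] := rat_approx (complex.Re (u i)) e4.
have [b hb] := rat_approx (complex.Im (u i)) e4.
exists ((i, (a, b)) :: q); rewrite /rat_comb !big_cons -/(rat_comb q) opprD addrACA.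
rewrite -scalerBl (le_lt_trans (ell2_normD _ _)) //.
have := ell2_norm_basisZ (u i - Complex (ratr a) (ratr b)) i.
by rewrite !raddfB /=; move: ha hb hq; lra.
Qed.

End Separable.

Lemma ell2_separable (R : realType) (I : countType) : separable_space (ell2 R I).
Proof.
exists (range (@rat_comb R I)).
  by apply: sub_countable (card_image_le _ _) _; exact: countableP.
move=> O [u Ou] Oo; have := open_nbhs_nbhs (conj Oo Ou).
rewrite -nbhs_ballE => -[e e0]; rewrite -ball_normE => eO.
have eE : e = (complex.Re e)%:C by rewrite RRe_real // gtr0_real.
have e2 : 0 < complex.Re e / 2 by move: e0; rewrite /= {1}eE ltcR => /divr_gt0->.
have [F hF] := ell2_truncation u e2.
have [q hq] := rat_comb_approx u F e2.
exists (rat_comb R q); split; last by exists q.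
apply: eO; rewrite /= eE ell2_normrE ltcR.
rewrite -(subrKA (\sum_(i <- F) u i *: ell2_basis R i)).
by rewrite (le_lt_trans (ell2_normD _ _)) // [ltRHS]splitr ltrD.
Qed.

(** * Transport of square-summable families along an injection *)

Section PartialInjection.
Variables (R : realType) (I : choiceType) (h k : I -> I).
(** Since [k] is a left inverse of [h], the condition [h (k j) != j] says that [j] is outside the
    range of [h]. Only moduli are compared, so signs are allowed; the setting covers both the group
    action and the non-surjective isometry. *)
Hypothesis hK : cancel h k.
Variables (x y : I -> R[i]).
Hypothesis yh : forall i, normsq (y (h i)) = normsq (x i).
Hypothesis y0 : forall j, h (k j) != j -> y j = 0.

Lemma fsum_push F : fsum (fun j => normsq (y j)) (h @` F)%fset = fsum (fun i => normsq (x i)) F.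
Proof.
rewrite /fsum big_imfset /=; first by apply: eq_bigr => i _; exact: yh.
by move=> i j _ _ /(can_inj hK).
Qed.

Lemma fsum_pull F : fsum (fun j => normsq (y j)) F <=
  fsum (fun i => normsq (x i)) (k @` F)%fset.
Proof.
rewrite -fsum_push.
have -> : fsum (fun j => normsq (y j)) F =
    fsum (fun j => normsq (y j)) [fset j in F | h (k j) == j]%fset.
  rewrite /fsum; symmetry; apply: big_fset_incl => [|j jF].
    by apply/fsubsetP => j; rewrite !inE => /andP[].
  rewrite !inE jF /= => /y0->.
  by rewrite normsq0.
apply: le_fsum => [j|]; first exact: normsq_ge0.
apply/fsubsetP => j; rewrite !inE /= => /andP[jF /eqP <-].
by rewrite !in_imfset.
Qed.

Lemma ell2_pull : x \in @ell2_pred R I -> y \in @ell2_pred R I.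
Proof.
move=> /asboolP[M hM]; apply/asboolP; exists M => F.
exact: le_trans (fsum_pull F) _.
Qed.

End PartialInjection.

Lemma ell2_norm_pull (R : realType) (I : choiceType) (h k : I -> I) (u v : ell2 R I) :
  cancel h k -> (forall i, normsq (v (h i)) = normsq (u i)) ->
  (forall j, h (k j) != j -> v j = 0) -> ell2_norm v = ell2_norm u.
Proof.
move=> hK vh v0; congr Num.sqrt; apply/le_anti/andP; split.
  apply: (usum_le (ell2_usummable v)) => F.
  exact: le_trans (fsum_pull hK vh v0 F) (fsum_le_sqnorm _ _).
apply: (usum_le (ell2_usummable u)) => F.
by rewrite -(fsum_push hK vh) fsum_le_sqnorm.
Qed.

Lemma ell2_inner_disjoint (R : realType) (I : choiceType) (u v : ell2 R I) :
  (forall i, u i = 0 \/ v i = 0) -> inner u v = 0.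
Proof.
move=> uv; have z i : u i * (v i)^*%C = 0.
  by case: (uv i) => ->; rewrite ?mul0r // conjc0 mulr0.
by apply: eq_Re_Im; rewrite -[RHS](usum0 R I);
  congr usum; apply/funext => i; rewrite z.
Qed.

(** * The integrated form of a unitary representation *)

Section RealNorm.
Variables (R : realType) (H : hilbertType R).
Implicit Types (x y l : H) (f : nat -> H).

Lemma rnorm0 : rnorm (0 : H) = 0.
Proof. by rewrite /rnorm normr0. Qed.

Lemma rnormN x : rnorm (- x) = rnorm x.
Proof. by rewrite /rnorm normrN. Qed.

Lemma rnormB x y : rnorm (x - y) = rnorm (y - x).
Proof. by rewrite -rnormN opprB. Qed.

Lemma rnorm_eq0 x : rnorm x = 0 -> x = 0.
Proof. by move=> x0; apply/normr0_eq0; rewrite rnormE x0. Qed.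

Lemma rnorm_dist x y : `|rnorm x - rnorm y| <= rnorm (x - y).
Proof.
have le u v : rnorm u - rnorm v <= rnorm (u - v).
  by rewrite lerBlDr -{1}(subrK v u) rnormD.
by rewrite ler_norml lerNl opprB rnormB !le rnormB le.
Qed.

(** Norms take values in [R[i]], where a positive number is real, so every radius is the image of
    its real part. This reduces convergence to real estimates. *)
Lemma cvgn_rnormP f l : (f @ \oo --> l) <->
  (forall e : R, 0 < e -> exists N, forall n, (N <= n)%N -> rnorm (l - f n) < e).
Proof.
split=> [/cvgrPdist_lt fl e e0|h].
  have [|N _ hN] := fl e%:C; first by rewrite ltcR.
  by exists N => n Nn; rewrite -ltcR -rnormE; exact: hN.
apply/cvgrPdist_lt => e e0.
have eE : e = (complex.Re e)%:C by rewrite RRe_real // gtr0_real.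
have [|N hN] := h (complex.Re e); first by move: e0; rewrite eE ltcR.
by exists N => // n Nn; rewrite eE rnormE ltcR; exact: hN.
Qed.

Lemma cvgn_rnorm f l : f @ \oo --> l -> rnorm (f n) @[n --> \oo] --> rnorm l.
Proof.
move=> /cvgn_rnormP fl; apply/cvgrPdist_lt => e /fl[N hN].
by exists N => // n /hN; apply: le_lt_trans; exact: rnorm_dist.
Qed.

Lemma Re_innerN x y : complex.Re (inner (- x) y) = - complex.Re (inner x y).
Proof. by rewrite -scaleN1r innerZl mulN1r raddfN. Qed.

Lemma Re_inner_norm_le x y : `|complex.Re (inner x y)| <= rnorm x * rnorm y.
Proof.
by rewrite ler_norml Re_inner_le lerNl -Re_innerN -(rnormN x) Re_inner_le.
Qed.

Lemma cvgn_Re_inner f l y : f @ \oo --> l ->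
  complex.Re (inner (f n) y) @[n --> \oo] --> complex.Re (inner l y).
Proof.
move=> /cvgn_rnormP fl; apply/cvgrPdist_lt => e e0.
have y1 : 0 < rnorm y + 1 by rewrite ltr_wpDl ?rnorm_ge0.
have [N hN] := fl _ (divr_gt0 e0 y1); exists N => // n /= /hN.
rewrite ltr_pdivlMr //; apply: le_lt_trans.
rewrite -raddfB /= -[- inner (f n) y]mulN1r -innerZl scaleN1r -innerDl.
by rewrite (le_trans (Re_inner_norm_le _ _)) // ler_wpM2l ?rnorm_ge0 // lerDl.
Qed.

Lemma Re_innerC x y : complex.Re (inner x y) = complex.Re (inner y x).
Proof. by rewrite innerC; case: (inner y x). Qed.

(** Allows an identity between complex inner products to be checked on real parts only, at [y] and
    at i [y]. *)
Lemma Im_inner x y : complex.Im (inner x y) = complex.Re (inner x ('i%C *: y)).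
Proof. by rewrite innerZr; case: (inner x y) => a b /=; ring. Qed.

Lemma bounded_continuous (T : {linear H -> H}) (M : R) :
  bounded_by M T -> continuous T.
Proof.
move=> TM x; apply/cvgrPdist_lt => e e0.
have eE : e = (complex.Re e)%:C by rewrite RRe_real // gtr0_real.
have e1 : 0 < complex.Re e by move: e0; rewrite eE ltcR.
have M1 : 0 < `|M| + 1 by rewrite ltr_wpDl.
have d0 : 0 < (complex.Re e / (`|M| + 1))%:C by rewrite ltcR divr_gt0.
apply/nbhs_ballP; exists (complex.Re e / (`|M| + 1))%:C => //= y.
rewrite -ball_normE /= rnormE ltcR ltr_pdivlMr // => xy.
rewrite -linearB eE rnormE ltcR (le_lt_trans (TM _)) //; apply: le_lt_trans xy.
rewrite mulrC ler_wpM2l ?rnorm_ge0 // (le_trans (ler_norm M)) // lerDl //.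
Qed.

(** The real part is polarisation of the norm; the imaginary part follows from it through
    [Im_inner]. *)
Lemma isometry_inner (T : {linear H -> H}) :
  (forall x, rnorm (T x) = rnorm x) -> forall x y, inner (T x) (T y) = inner x y.
Proof.
move=> Tiso; have ReT x y : complex.Re (inner (T x) (T y)) = complex.Re (inner x y).
  have polar (u v : H) : rnorm (u + v) ^+ 2 =
      rnorm u ^+ 2 + rnorm v ^+ 2 + complex.Re (inner u v) *+ 2.
    rewrite -[LHS]/(complex.Re (rnorm (u + v) ^+ 2)%:C) -rnorm_sqr.
    rewrite innerDl !innerDr !raddfD /= (Re_innerC v u) !rnorm_sqr /=; ring.
  have := polar (T x) (T y); rewrite -linearD !Tiso polar.
  by move=> /addrI /eqP; rewrite eqrMn2r // => /eqP.
move=> x y; apply/eqP; rewrite eq_complex ReT eqxx /=.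
by rewrite !Im_inner -linearZ ReT.
Qed.

End RealNorm.

Section IntegratedForm.
Variables (R : realType) (G : groupType) (H : hilbertType R) (pi : unitary_rep G H).
Local Notation A := (group_algebra R G).
Local Notation Ahat := (group_cstar R G).
Implicit Types (a b : A) (s t : cauchy_sequence A) (X Y : Ahat) (x y : H).

Lemma rnorm_urep_alg_le a x : rnorm (urep_alg pi a x) <= pnorm a * rnorm x.
Proof. exact: universal_norm_bound. Qed.

Lemma urep_algB a b x : urep_alg pi (a - b) x = urep_alg pi a x - urep_alg pi b x.
Proof. by rewrite urep_algD -scaleN1r urep_algZ scaleN1r. Qed.

(** Extension by continuity from the dense group algebra, computed along a chosen Cauchy
    representative of [X]; [urep_hat_class_cvg] shows that the choice does not matter. *)
Definition urep_hat X x : H := limn (fun n => urep_alg pi (repr X n : A) x).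

Lemma urep_alg_null (u : nat -> A) x : pnull u ->
  urep_alg pi (u n) x @[n --> \oo] --> (0 : H).
Proof.
move=> u0; apply/cvgn_rnormP => e e0.
have x1 : 0 < rnorm x + 1 by rewrite ltr_wpDl ?rnorm_ge0.
have [N hN] := u0 _ (divr_gt0 e0 x1); exists N => n /hN.
rewrite ltr_pdivlMr //; apply: le_lt_trans.
rewrite sub0r rnormN (le_trans (rnorm_urep_alg_le _ _)) //.
by rewrite ler_wpM2l ?pnorm_ge0 // lerDl.
Qed.

Lemma urep_alg_cvg s x : cvgn (fun n => urep_alg pi (s n : A) x).
Proof.
apply: cauchy_cvg; apply/cauchyP => e e0.
have eE : e = (complex.Re e)%:C by rewrite RRe_real // gtr0_real.
have e1 : 0 < complex.Re e by move: e0; rewrite eE ltcR.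
have x1 : 0 < rnorm x + 1 by rewrite ltr_wpDl ?rnorm_ge0.
have [N hN] := cseqP s (divr_gt0 e1 x1).
exists (urep_alg pi (s N) x), N => //= n /= Nn; rewrite -ball_normE /=.
rewrite -urep_algB eE rnormE ltcR (le_lt_trans (rnorm_urep_alg_le _ _)) //.
have := hN _ _ (leqnn N) Nn; rewrite ltr_pdivlMr //; apply: le_lt_trans.
by rewrite ler_wpM2l ?pnorm_ge0 // lerDl.
Qed.

(** Two representatives of a class differ by a null sequence, whose operators tend to 0 at each
    vector. *)
Lemma urep_hat_class_cvg s x :
  urep_alg pi (s n : A) x @[n --> \oo] --> urep_hat (hat_class s) x.
Proof.
have h1 : urep_alg pi (repr (hat_class s) n : A) x @[n --> \oo] --> urep_hat (hat_class s) x.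
  exact: urep_alg_cvg.
rewrite (_ : (fun n => _) = fun n => urep_alg pi (repr (hat_class s) n : A) x -
    urep_alg pi (repr (hat_class s) n - s n : A) x).
  by rewrite -[urep_hat _ _]subr0; apply: cvgB h1 _; exact: urep_alg_null (hat_repr s).
by apply/funext => n; rewrite urep_algB opprB addrC subrK.
Qed.

Lemma urep_hat_unique s x (l : H) :
  urep_alg pi (s n : A) x @[n --> \oo] --> l -> urep_hat (hat_class s) x = l.
Proof. by move=> h; apply: (cvg_unique (@norm_hausdorff _ _) (@urep_hat_class_cvg s x) h). Qed.

Lemma urep_hat_linear X : linear (urep_hat X).
Proof.
elim/hat_ind: X => s c x y; apply: urep_hat_unique.
under eq_fun do rewrite linearP.
by apply: cvgD; [apply: cvgZ; first exact: cvg_cst|]; exact: urep_hat_class_cvg.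
Qed.

HB.instance Definition _ X := GRing.isLinear.Build R[i] H H _ (urep_hat X) (urep_hat_linear X).

Lemma urep_hat_bounded X : bounded_by (hat_norm X) (urep_hat X).
Proof.
elim/hat_ind: X => s x.
apply: (@ler_cvg_to _ \oo _ _ (fun n => rnorm (urep_alg pi (s n : A) x))
  (fun n => pnorm (s n : A) * rnorm x)).
- by apply: cvgn_rnorm; exact: urep_hat_class_cvg.
- by apply: cvgMl; exact: hat_norm_lim.
- by apply: nearW => n; exact: rnorm_urep_alg_le.
Qed.

Lemma urep_hat_continuous X : continuous (urep_hat X).
Proof. exact: bounded_continuous (@urep_hat_bounded X). Qed.

Definition urep_hat_op X : bounded_op H := BoundedOp (@urep_hat_continuous X).

Lemma urep_hat_algebra_linear c X Y x :
  urep_hat_op (c *: X + Y) x = c *: urep_hat_op X x + urep_hat_op Y x.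
Proof.
elim/hat_ind: X => s; elim/hat_ind: Y => t.
rewrite /= hat_classZ hat_classD; apply: urep_hat_unique => /=.
under eq_fun do rewrite urep_algD urep_algZ.
by apply: cvgD; [apply: cvgZ; first exact: cvg_cst|]; exact: urep_hat_class_cvg.
Qed.

Lemma urep_hatM X Y x : urep_hat_op (cmul X Y) x = urep_hat_op X (urep_hat_op Y x).
Proof.
elim/hat_ind: X => s; elim/hat_ind: Y => t.
rewrite /= [cmul _ _]hat_mulE; apply: urep_hat_unique => /=.
under eq_fun do rewrite urep_algM.
set y := urep_hat _ x.
(* Split s_n t_n x as s_n y + s_n (t_n x - y). The second term vanishes in the limit because a
   Cauchy sequence is bounded in norm. *)
rewrite -[_ (hat_class s) y]addr0.
have h : urep_alg pi (s n : A) (urep_alg pi (t n : A) x - y) @[n --> \oo] --> (0 : H).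
  have [K K0 hK] := cseq_bounded s.
  apply/cvgn_rnormP => e e0.
  have [N hN] := (cvgn_rnormP _ _).1 (urep_hat_class_cvg (s := t) (x := x)) _ (divr_gt0 e0 K0).
  exists N => n /hN; rewrite ltr_pdivlMr // -/y => yn.
  rewrite sub0r rnormN; apply: le_lt_trans yn; rewrite mulrC rnormB.
  by rewrite (le_trans (rnorm_urep_alg_le _ _)) // ler_wpM2r ?rnorm_ge0.
rewrite (_ : (fun n => _) = fun n => urep_alg pi (s n : A) y +
    urep_alg pi (s n : A) (urep_alg pi (t n : A) x - y)).
  by apply: cvgD h; exact: urep_hat_class_cvg.
by apply/funext => n; rewrite -linearD addrC subrK.
Qed.

Lemma Re_ureph_star X x y :
  complex.Re (inner (urep_hat X x) y) = complex.Re (inner x (urep_hat (cstar X) y)).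
Proof.
elim/hat_ind: X => s; rewrite [cstar _]hat_starE [in RHS]Re_innerC.
have h1 := cvgn_Re_inner (y := y) (urep_hat_class_cvg (s := s) (x := x)).
have h2 := cvgn_Re_inner (y := x)
  (urep_hat_class_cvg (s := CauchySequence (pcauchy_star s)) (x := y)).
rewrite (_ : (fun n => _) = fun n => complex.Re (inner (urep_alg pi (s n : A) x) y)) in h2.
  by rewrite (cvg_unique (@Rhausdorff R) h1 h2).
by apply/funext => n; rewrite [in RHS]urep_algJ Re_innerC.
Qed.

Lemma urep_hat_star X x y :
  inner (urep_hat_op X x) y = inner x (urep_hat_op (cstar X) y).
Proof.
apply/eqP; rewrite eq_complex; apply/andP; split; apply/eqP.
  exact: Re_ureph_star.
by rewrite !Im_inner Re_ureph_star linearZ.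
Qed.

Definition integrated_form : representation Ahat H :=
  Representation urep_hat_algebra_linear urep_hatM urep_hat_star.

Lemma integrated_form_inj a x : integrated_form (hat_inj a) x = urep_alg pi a x.
Proof. by apply: (@urep_hat_unique (CauchySequence (pcauchy_cst a))) => /=; exact: cvg_cst. Qed.

End IntegratedForm.

(** * Isometries in quasidiagonal sets *)

Section Orthonormal.
Variables (R : realType) (H : hilbertType R).
Local Notation C := R[i].
Implicit Types (x y z : H).

Lemma innerBl x y z : inner (x - y) z = inner x z - inner y z.
Proof. by rewrite innerDl -scaleN1r innerZl mulN1r. Qed.

Lemma innerBr x y z : inner x (y - z) = inner x y - inner x z.
Proof. by rewrite innerDr -scaleN1r innerZr rmorphN1 mulN1r. Qed.

Lemma inner_suml (T : Type) (r : seq T) (f : T -> H) z :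
  inner (\sum_(t <- r) f t) z = \sum_(t <- r) inner (f t) z.
Proof.
by elim: r => [|t r ih]; rewrite ?big_nil ?inner0l // !big_cons innerDl ih.
Qed.

Definition orthonormal_family m (e : 'I_m -> H) : Prop :=
  forall i j, inner (e i) (e j) = (i == j)%:R.

Lemma rnorm_orthonormal m (e : 'I_m -> H) i : orthonormal_family e -> rnorm (e i) = 1.
Proof.
move=> /(_ i i); rewrite eqxx rnorm_sqr => /complexI /eqP.
by rewrite sqrf_eq1 => /orP[/eqP//|/eqP h]; have := rnorm_ge0 (e i); lra.
Qed.

Lemma rnorm_orthonormalB m (e : 'I_m -> H) i j : orthonormal_family e -> i != j ->
  1 < rnorm (e i - e j).
Proof.
move=> eo ij; have : inner (e i - e j) (e i - e j) = 2%:R.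
  rewrite innerBl !innerBr !eo !eqxx (negbTE ij) eq_sym (negbTE ij) /=.
  by ring.
rewrite rnorm_sqr -(rmorph_nat (real_complex R)) => /complexI h.
by rewrite -(@ltr_pXn2r _ 2) ?nnegrE ?rnorm_ge0 // h expr1n ltr1n.
Qed.

Lemma orthonormal_coord m (e : 'I_m -> H) (a : 'I_m -> C) j : orthonormal_family e ->
  inner (\sum_i a i *: e i) (e j) = a j.
Proof.
move=> eo; rewrite inner_suml (bigD1 j) //= innerZl eo eqxx mulr1.
rewrite big1 ?addr0 // => i ij.
by rewrite innerZl eo (negbTE ij) mulr0.
Qed.

(** Pigeonhole: orthonormal vectors are more than 1 apart, so a ball of radius 1/2 holds at most one
    of them, and finitely many such balls cover the image of the unit ball, which contains every
    [e i]. *)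
Lemma compact_orthonormal_size (P : H -> H) : compact_op P ->
  exists N, forall m (e : 'I_m -> H), orthonormal_family e -> (forall i, P (e i) = e i) ->
    (m <= N)%N.
Proof.
rewrite /compact_op compact_cover.
move=> /(_ H setT (fun c => ball c (2^-1 : C))) [].
- by move=> c _; apply: ball_open; rewrite invr_gt0.
- by move=> x _; exists x => //; apply: ballxx; rewrite invr_gt0.
move=> D _ Dc; exists (size D) => m e eo Pe.
have /choice[c hc] : forall i, exists c, c \in D /\ rnorm (c - e i) < 2^-1.
  move=> i; have [] : (\bigcup_(c in [set c | c \in D]) ball c (2^-1 : C)) (e i).
    apply: Dc; apply: subset_closure; exists (e i); last exact: Pe.
    by rewrite /= rnormE rnorm_orthonormal.
  move=> c /= cD; rewrite -ball_normE /= rnormE => ce; exists c; split=> //.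
  by rewrite -ltcR (lt_le_trans ce) // fmorphV rmorph_nat.
rewrite -[m]size_enum_ord -(size_map c); apply: uniq_leq_size.
  rewrite map_inj_uniq ?enum_uniq // => i j cij; apply/eqP/negPn/negP => ij.
  have := rnorm_orthonormalB eo ij; apply/negP; rewrite -leNgt.
  rewrite -(subrKA (c i)) (le_trans (rnormD _ _)) //.
  have [_ hi] := hc i; have [_ hj] := hc j; rewrite -cij in hj.
  by rewrite rnormB; lra.
by move=> _ /mapP[i _ ->]; have [] := hc i.
Qed.

End Orthonormal.

(** * Compressions to the range of a compact projection *)

Section CompactProjection.
Variables (R : realType) (H : hilbertType R) (P : {linear H -> H}).
Local Notation C := R[i].
Hypotheses (Pc : compact_op P) (Pp : orthogonal_projection P).
Implicit Types (x y z : H).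

Lemma projection_idem x : P (P x) = P x. Proof. exact: Pp.1. Qed.
Lemma projection_adj x y : inner (P x) y = inner x (P y). Proof. exact: Pp.2. Qed.

Lemma rnorm_projection_sqr x : complex.Re (inner (P x) x) = rnorm (P x) ^+ 2.
Proof. by rewrite -[in LHS]projection_idem projection_adj rnorm_sqr. Qed.

Lemma rnorm_projection_le x : rnorm (P x) <= rnorm x.
Proof.
have [->|x0] := eqVneq (rnorm (P x)) 0; first exact: rnorm_ge0.
have := Re_inner_le (P x) x; rewrite rnorm_projection_sqr expr2 ler_pM2l //.
by rewrite lt_def x0 rnorm_ge0.
Qed.

(** An orthonormal family of maximal size in the range of [P] spans it: otherwise the normalised
    residual of a vector of the range would enlarge the family. *)
Lemma projection_orthonormal_basis : exists m (e : 'I_m -> H),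
  [/\ orthonormal_family e, forall i, P (e i) = e i
    & forall x, P x = x -> x = \sum_i inner x (e i) *: e i].
Proof.
have [N hN] := compact_orthonormal_size Pc.
pose Q m := `[< exists e : 'I_m -> H, orthonormal_family e /\ forall i, P (e i) = e i >].
have Q0 : exists m, Q m.
  exists 0%N; apply/asboolP; exists (fun=> 0).
  by split=> [i|i]; case: (i).
have QN m : Q m -> (m <= N)%N.
  by move=> /asboolP[e [eo Pe]]; exact: hN Pe.
have [m /asboolP[e [eo Pe]] mmax] := ex_maxnP Q0 QN.
exists m, e; split=> // x Px; apply/eqP; rewrite -subr_eq0; apply/negPn/negP.
set y := x - _ => y0.
have ye i : inner y (e i) = 0 by rewrite innerBl orthonormal_coord // subrr.
have Py : P y = y.
  rewrite linearB Px linear_sum; congr (_ - _); apply: eq_bigr => i _.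
  by rewrite linearZ Pe.
have r0 : 0 < rnorm y by rewrite -ltcR -rnormE normr_gt0.
pose z := (rnorm y)^-1%:C *: y.
have ze i : inner z (e i) = 0 by rewrite innerZl ye mulr0.
have zz : inner z z = 1.
  rewrite innerZl innerZr rnorm_sqr conjc_real -!rmorphM -(rmorph1 (real_complex R)).
  by congr (_%:C); field; rewrite gt_eqF.
have : Q m.+1.
  (* The new vector [z] takes index 0 and the old family is shifted by one. *)
  apply/asboolP; exists (fun i => oapp e z (unlift ord0 i)); split=> [i j|i]; last first.
    by case: unliftP => [i' _|_] /=; rewrite ?Pe // linearZ Py.
  case: (unliftP ord0 i) => [i' ->|->]; case: (unliftP ord0 j) => [j' ->|->];
    rewrite ?eqxx ?zz // ?(inj_eq lift_inj) ?eo //.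
  - by rewrite eq_sym (negbTE (neq_lift _ _)) innerC ze conjc0.
  - by rewrite (negbTE (neq_lift _ _)) ze.
by move=> /mmax; rewrite ltnn.
Qed.

(* The range of [P] is finite-dimensional, so injectivity of the compression
   of [T] to it implies surjectivity. *)
Lemma compression_surjective (T : {linear H -> H}) :
  (forall x, P x = x -> P (T x) = 0 -> x = 0) ->
  forall y, P y = y -> exists2 x, P x = x & P (T x) = y.
Proof.
move=> Tinj y Py; have [m [e [eo Pe span]]] := projection_orthonormal_basis.
(* Row [i] holds the coordinates of P T (e i), so the compression acts on coordinate row vectors by
   multiplication by [A] on the right. *)
pose A : 'M[C]_m := \matrix_(i, j) inner (T (e i)) (e j).
pose comb (a : 'rV[C]_m) : H := \sum_i a 0 i *: e i.
have Pcomb a : P (comb a) = comb a.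
  by rewrite linear_sum; apply: eq_bigr => i _; rewrite linearZ Pe.
have combA a j : inner (P (T (comb a))) (e j) = (a *m A) 0 j.
  rewrite projection_adj Pe linear_sum inner_suml mxE; apply: eq_bigr => i _.
  by rewrite linearZ innerZl mxE.
have Pext x x' : P x = x -> P x' = x' ->
    (forall j, inner x (e j) = inner x' (e j)) -> x = x'.
  move=> Px Px' xx'; rewrite (span x Px) (span x' Px').
  by apply: eq_bigr => i _; rewrite xx'.
have Au : A \in unitmx.
  rewrite -row_free_unit; apply: inj_row_free => a aA.
  have /Tinj : P (comb a) = comb a by [].
  have -> : P (T (comb a)) = 0.
    apply: Pext; rewrite ?projection_idem ?linear0 // => j.
    by rewrite combA aA mxE inner0l.
  move=> /(_ erefl) a0; apply/rowP => j.
  by rewrite -(orthonormal_coord (a 0) j eo) -/(comb a) a0 inner0l mxE.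
pose b : 'rV[C]_m := (\row_j inner y (e j)) *m invmx A.
exists (comb b) => //; apply: Pext; rewrite ?projection_idem // => j.
by rewrite combA /b mulmxKV // mxE.
Qed.

(** Named in order to carry a linear structure, which [opnorm_bound] asks for. *)
Definition commutator (S T : {linear H -> H}) x := S (T x) - T (S x).

Lemma commutator_linear S T : linear (commutator S T).
Proof.
by move=> c x y; rewrite /commutator !(linearD, linearZ) /= addrACA.
Qed.

HB.instance Definition _ S T :=
  GRing.isLinear.Build C H H _ (commutator S T) (commutator_linear S T).

Lemma rnorm_commutator_le (S : {linear H -> H}) x :
  (forall x, rnorm (S x) = rnorm x) ->
  rnorm (P (S x) - S (P x)) <= opnorm (fun x => P (S x) - S (P x)) * rnorm x.
Proof.
(* The constant 2 is immaterial: a finite bound is needed only for the supremum defining [opnorm] to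
   be over a bounded set. *)
move=> Siso; apply: (@opnorm_bound _ _ 2 (commutator P S)) => {}x.
rewrite /commutator (le_trans (rnormD _ _)) // rnormN Siso mulr_natl mulr2n lerD //.
  by rewrite (le_trans (rnorm_projection_le _)) // Siso.
exact: rnorm_projection_le.
Qed.

Lemma almost_commuting_isometry (S : {linear H -> H}) z :
  (forall x, rnorm (S x) = rnorm x) -> (forall x, inner (S x) z = 0) ->
  opnorm (fun x => P (S x) - S (P x)) < 4^-1 -> 3 / 4 * rnorm z <= rnorm (P z) ->
  z = 0.
Proof.
move=> Siso Sz com4 Pz.
have com x : P x = x -> rnorm (P (S x) - S x) <= 4^-1 * rnorm x.
  move=> Px; rewrite -[in X in _ - S X]Px.
  by rewrite (le_trans (rnorm_commutator_le x Siso)) // ler_wpM2r ?rnorm_ge0 // ltW.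
have low x : P x = x -> 3 / 4 * rnorm x <= rnorm (P (S x)).
  move=> Px; have := com _ Px; rewrite rnormB => h.
  have := rnormD (S x - P (S x)) (P (S x)); rewrite subrK Siso; lra.
have [x Px PSx] : exists2 x, P x = x & P (S x) = P z.
  apply: compression_surjective; last exact: projection_idem.
  move=> x /low; move=> h h0; apply: rnorm_eq0.
  by move: h; rewrite h0 rnorm0; have := rnorm_ge0 x; lra.
have := low _ Px; rewrite PSx => lowx.
have h1 : rnorm (P z) ^+ 2 <= 4^-1 * rnorm x * rnorm z.
  rewrite -rnorm_projection_sqr -PSx.
  have -> : inner (P (S x)) z = inner (P (S x) - S x) z by rewrite innerBl Sz subr0.
  rewrite (le_trans (Re_inner_le _ _)) // ler_wpM2r ?rnorm_ge0 //.
  exact: com.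
have zx := rnorm_projection_le z.
apply: rnorm_eq0; apply/eqP; apply/negPn/negP => z0.
have zpos : 0 < rnorm z by rewrite lt_def z0 rnorm_ge0.
have h2 : (3 / 4 * rnorm z) ^+ 2 <= rnorm (P z) ^+ 2.
  by rewrite ler_pXn2r ?nnegrE ?rnorm_ge0 //; lra.
have h3 : rnorm x * rnorm z <= 4 / 3 * rnorm z * rnorm z.
  by rewrite ler_wpM2r ?rnorm_ge0 //; lra.
have h4 : 0 < rnorm z * rnorm z by rewrite mulr_gt0.
move: h1 h2 h3 h4; rewrite !expr2; lra.
Qed.

End CompactProjection.

(** The range of an isometry is closed, so this says that every isometry in a quasidiagonal set is
    onto. *)
Lemma quasidiagonal_isometry (R : realType) (H : hilbertType R)
    (Omega : set (bounded_op H)) (S : bounded_op H) z :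
  quasidiagonal Omega -> Omega S -> (forall x, rnorm (S x) = rnorm x) ->
  (forall x, inner (S x) z = 0) -> z = 0.
Proof.
move=> [P [Pcp _ Pz PT]] OS Siso Sz.
have [z0|z0] := eqVneq (rnorm z) 0; first exact: rnorm_eq0.
have c0 : 0 < rnorm z by rewrite lt_def z0 rnorm_ge0.
have e0 : 0 < (4^-1 : R) by rewrite invr_gt0.
have /cvgrPdist_lt /(_ _ e0)[N _ hN] := PT _ OS.
have [M hM] := (cvgn_rnormP _ _).1 (Pz z) _ (mulr_gt0 e0 c0).
have [Pc Pp] := Pcp (maxn N M).
apply: (almost_commuting_isometry Pc Pp Siso Sz).
  have := hN _ (leq_maxl N M); rewrite /= sub0r normrN; apply: le_lt_trans.
  exact: ler_norm.
have := hM _ (leq_maxr N M); have := rnormD (z - P (maxn N M) z) (P (maxn N M) z).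
by rewrite subrK; lra.
Qed.

(** * A representation of the lamplighter group *)

Section PartialShift.
Variables (R : realType) (G : groupType) (t s : G).

Definition partial_shift : group_algebra R G :=
  << 2^-1 *g t >> + << - 2^-1 *g (t * s)%g >> + (<< 2^-1 *g 1%g >> + << 2^-1 *g s >>).

Lemma urep_partial_shift (H : hilbertType R) (pi : unitary_rep G H) x :
  urep_alg pi partial_shift x = 2^-1 *: (pi t (x - pi s x) + (x + pi s x)).
Proof.
rewrite /partial_shift !urep_algD !urep_algU urepM urep1 linearB.
by rewrite !scalerDr scalerN scaleNr.
Qed.

End PartialShift.

Section Lamplighter.
Variable R : realType.
Local Notation C := R[i].
Local Notation H := (ell2 R int).
Local Notation lamps := {malg 'Z_2[int]}.
Implicit Types (f : lamps) (i j n : int) (g h : lamplighter) (u v : H).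

(** The exponent of the character of the lamp group given by the indicator of ]-oo, i]. *)
Definition parity i f : 'Z_2 :=
  malg_ext (fun j (c : 'Z_2) => if (j <= i)%R then c else 0) f.

Lemma parity_term_additive i j :
  {morph (fun c : 'Z_2 => if (j <= i)%R then c else 0) : c d / c - d}.
Proof. by move=> c d /=; case: ifP => // _; rewrite subr0. Qed.

Lemma parityD i f f' : parity i (f + f') = parity i f + parity i f'.
Proof. exact: malg_extD (parity_term_additive i) _ _. Qed.

Lemma parity0 i : parity i 0 = 0.
Proof. exact: malg_ext0 (parity_term_additive i). Qed.

Lemma parityU i j c : parity i << c *g j >> = if (j <= i)%R then c else 0.
Proof. exact: (malg_extU (parity_term_additive i)). Qed.

(** Moving the lamps moves the cut point. This covariance is what makes [lamp_op] multiplicative on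
    the semidirect product. *)
Lemma parity_shift i n f : parity i (Defs.shift n f) = parity (i - n) f.
Proof.
elim/malg_ind: f => [|f f' h h'|c j].
- by rewrite shiftn0 !parity0.
- by rewrite shiftD !parityD h h'.
- by rewrite shiftU !parityU lerBrDr.
Qed.

Definition Z2_sign (c : 'Z_2) : C := (-1) ^+ c.

Lemma Z2_signD c d : Z2_sign (c + d) = Z2_sign c * Z2_sign d.
Proof. by rewrite /Z2_sign -exprD -[RHS]signr_odd -modn2. Qed.

Lemma normsq_sign c z : normsq (Z2_sign c * z) = normsq z.
Proof.
rewrite normsqM (_ : normsq (Z2_sign c) = 1) ?mul1r //.
rewrite /Z2_sign -signr_odd; case: odd => /=.
  by rewrite expr1 /normsq /= oppr0 expr0n sqrrN expr1n addr0.
by rewrite expr0 /normsq /= expr0n expr1n addr0.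
Qed.

(** The pair (f, n) is the product of f and the n-th power of the move, so the translation acts
    first and the sign is read at the new position. *)
Definition lamp_fun g (x : int -> C) i : C := Z2_sign (parity i g.1) * x (i - g.2).

Lemma lamp_fun_pull g (x : int -> C) i : normsq (lamp_fun g x (i + g.2)) = normsq (x i).
Proof. by rewrite /lamp_fun addrK normsq_sign. Qed.

Lemma lamp_fun_ell2 g u : lamp_fun g u \in @ell2_pred R int.
Proof.
apply: (ell2_pull (addrK g.2) (lamp_fun_pull g u)) (ell2P u) => j.
by rewrite subrK eqxx.
Qed.

Definition lamp_op g u : H := Ell2 (lamp_fun_ell2 g u).

Lemma lamp_opE g u i : lamp_op g u i = Z2_sign (parity i g.1) * u (i - g.2).
Proof. by []. Qed.

Lemma lamp_op_linear g : linear (lamp_op g).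
Proof.
move=> c u v; apply: ell2_ext => i.
by rewrite ell2DE ell2ZE !lamp_opE ell2DE ell2ZE mulrDr mulrCA.
Qed.

HB.instance Definition _ g := GRing.isLinear.Build C H H _ (lamp_op g) (lamp_op_linear g).

Lemma lamp_op1 u : lamp_op 1%g u = u.
Proof.
by apply: ell2_ext => i; rewrite lamp_opE parity0 /Z2_sign expr0 mul1r subr0.
Qed.

Lemma lamp_opM g h u : lamp_op (g * h)%g u = lamp_op g (lamp_op h u).
Proof.
apply: ell2_ext => i; rewrite !lamp_opE /= parityD parity_shift Z2_signD -mulrA.
by rewrite opprD addrA.
Qed.

Lemma lamp_op_norm g u : rnorm (lamp_op g u) = rnorm u.
Proof.
rewrite !ell2_rnorm.
apply: (@ell2_norm_pull _ _ _ _ u (lamp_op g u) (addrK g.2)) => [i|j].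
  exact: lamp_fun_pull.
by rewrite subrK eqxx.
Qed.

Lemma lamp_op_inner g u v : inner (lamp_op g u) (lamp_op g v) = inner u v.
Proof. exact: isometry_inner (lamp_op_norm g) u v. Qed.

Definition lamp_rep : unitary_rep lamplighter H :=
  UnitaryRep lamp_op1 lamp_opM lamp_op_inner.

Lemma lamp_repE g u : lamp_rep g u = lamp_op g u.
Proof. by []. Qed.

Definition lamp_switch : lamplighter := (<< 1%R *g 0%R >>, 0%R).
Definition lamp_move : lamplighter := (0%R, 1%R).

(* [(1 - lamp_switch) / 2] acts as the projection onto [l^2(N)]; the element
   moves that half-line one step to the right and fixes its complement. *)
Definition lamp_isometry : group_algebra R lamplighter :=
  partial_shift R lamp_move lamp_switch.

Lemma lamp_op_switch u i : lamp_op lamp_switch u i = if (0 <= i)%R then - u i else u i.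
Proof.
rewrite lamp_opE parityU subr0; case: ifP => _; rewrite /Z2_sign.
  by rewrite expr1 mulN1r.
by rewrite expr0 mul1r.
Qed.

Lemma lamp_op_move u i : lamp_op lamp_move u i = u (i - 1).
Proof. by rewrite lamp_opE parity0 /Z2_sign expr0 mul1r. Qed.

Lemma lamp_isometryE u i : urep_alg lamp_rep lamp_isometry u i =
  if (1 <= i)%R then u (i - 1) else if (0 <= i)%R then 0 else u i.
Proof.
rewrite urep_partial_shift ell2ZE !ell2DE !lamp_repE lamp_op_move ell2BE.
rewrite !lamp_op_switch.
have -> : (0 <= i - 1)%R = (1 <= i)%R by rewrite subr_ge0.
have [i1|i1] := boolP (1 <= i)%R.
  rewrite (le_trans _ i1) //.
  by field.
(* The first case is i = 0. There both summands vanish: the projection onto l^2(N) kills coordinate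
   -1, which the move would bring to 0, and its complement kills coordinate 0. This is the gap in
   the range. *)
by case: ifP => _; field.
Qed.

End Lamplighter.

Section PartialShiftIsometry.
Variable R : realType.
Local Notation H := (ell2 R int).
Implicit Types (u : H) (i j : int).

(** [push] misses exactly 0. Its left inverse [pull] fixes 0 by convention, and [push (pull 0)] is
    1, so the range test of [ell2_norm_pull] singles out 0, where the image of the isometry
    vanishes. *)
Let push i : int := if (0 <= i)%R then i + 1 else i.
Let pull j : int := if (1 <= j)%R then j - 1 else j.

Lemma lamp_isometry_norm u :
  rnorm (urep_alg (lamp_rep R) (lamp_isometry R) u) = rnorm u.
Proof.
have pushK : cancel push pull.
  by move=> i; rewrite /push /pull; do 2 case: ifP; lia.
rewrite !ell2_rnorm.
apply: (@ell2_norm_pull _ _ _ _ _ _ pushK) => [i|j].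
  rewrite lamp_isometryE /push; have [i0|/negbTE i0] := boolP (0 <= i)%R.
    by rewrite (_ : (1 <= i + 1)%R = true) ?addrK //; lia.
  by rewrite i0 (_ : (1 <= i)%R = false) //; lia.
rewrite lamp_isometryE /push /pull.
have [j1|j1] := boolP (1 <= j)%R; first by rewrite subr_ge0 j1 subrK eqxx.
by case: ifP => //; rewrite eqxx.
Qed.

Lemma lamp_isometry_orthogonal u :
  inner (urep_alg (lamp_rep R) (lamp_isometry R) u) (ell2_basis R (0 : int)) = 0.
Proof.
apply: ell2_inner_disjoint => i; rewrite lamp_isometryE ell2_basisE.
by case: (eqVneq i 0) => [->|_]; [left|right].
Qed.

End PartialShiftIsometry.

Theorem corollary3p5 (R : realType) :
  ~ strongly_quasidiagonal (group_cstar R lamplighter).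
Proof.
move=> /(_ (ell2 R int) (integrated_form (lamp_rep R)) (ell2_separable R int)) qd.
pose b : group_cstar R lamplighter := hat_inj (lamp_isometry R).
have SE u : integrated_form (lamp_rep R) b u =
    urep_alg (lamp_rep R) (lamp_isometry R) u by exact: integrated_form_inj.
have : ell2_basis R (0 : int) = 0.
  apply: (quasidiagonal_isometry qd (S := integrated_form (lamp_rep R) b)).
  - by exists b.
  - by move=> u; rewrite SE lamp_isometry_norm.
  - by move=> u; rewrite SE lamp_isometry_orthogonal.
move=> /(congr1 (fun v : ell2 R int => v 0)) /eqP.
by rewrite ell2_basisE ell20E oner_eq0.
Qed.
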